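(* Let $\gamma>0$ and $\theta>1$, and put $\sigma_1=1-\sqrt{1-\theta}$, $\sigma_2=1+\sqrt{1-\theta}$ (complex conjugate numbers). For $t\in(0,\gamma^{-1})$ let $u(t,\cdot)$ be the measure on $(0,\infty)$ given by $$u(t,x)=(1-\gamma t)^{\frac1\gamma}\,\delta\left(x-(1-\gamma t)^{-\frac1\gamma}\right)+\theta(1-\gamma t)^{\frac2\gamma}\,t\,F\left(1+\frac{\sigma_1}{\gamma},1+\frac{\sigma_2}{\gamma},2,\gamma t\left(1+(\gamma t-1)x^\gamma\right)\right)H\left(1-(1-\gamma t)^{\frac1\gamma}x\right).$$ Then $$\lim_{\gamma t\to1^-}u(t,x)=\frac{\gamma\,\Gamma\left(\frac2\gamma\right)}{\Gamma\left(\frac{\sigma_1}{\gamma}\right)\Gamma\left(\frac{\sigma_2}{\gamma}\right)}(1+x^\gamma)^{-\frac2\gamma}\qquad\text{for all }x>0,$$ and $u$ blows up in finite time in the following sense (limits being taken as $t\to\gamma^{-1}$ with $t<\gamma^{-1}$): (i) for all $r>1$, $$\lim_{t\to\gamma^{-1}}(1-\gamma t)^{\frac{r-1}{\gamma}}\int_0^\infty x^r u(t,x)\,dx=\frac{\Gamma\left(\frac{r+1}{\gamma}\right)\Gamma\left(\frac{r-1}{\gamma}\right)}{\Gamma\left(\frac{r+1-\sigma_1}{\gamma}\right)\Gamma\left(\frac{r+1-\sigma_2}{\gamma}\right)};$$ (ii) $$\lim_{t\to\gamma^{-1}}\frac{-1}{\log(1-\gamma t)}\int_0^\infty x\,u(t,x)\,dx=\frac{\Gamma\left(\frac{2}{\gamma}\right)}{\Gamma\left(\frac{\sigma_1}{\gamma}\right)\Gamma\left(\frac{\sigma_2}{\gamma}\right)};$$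 (iii) for all $r\in(0,1)$, $$\lim_{t\to\gamma^{-1}}\int_0^\infty x^r u(t,x)\,dx=\frac{\Gamma\left(\frac{r+1}{\gamma}\right)\Gamma\left(\frac{1-r}{\gamma}\right)}{\Gamma\left(\frac{\sigma_1}{\gamma}\right)\Gamma\left(\frac{\sigma_2}{\gamma}\right)}.$$
   Context: $F(a,b,c,z)={}_2F_1(a,b;c;z)$ is the Gauss hypergeometric function (principal branch on $\mathbb C\setminus[1,\infty)$), $\Gamma$ is Euler's Gamma function, $H$ is Heaviside's function (equal to $1$ on $(0,\infty)$ and $0$ on $(-\infty,0)$), and $\delta(x-a)$ is the Dirac mass at $a$. Functions of $x$ are identified with the measures having them as densities, and $\int_0^\infty x^ru(t,x)\,dx$ means the integral of $x^r$ against the measure $u(t,\cdot)$, including its Dirac part. In the pointwise limit at a fixed $x>0$, the Dirac mass sits at $(1-\gamma t)^{-1/\gamma}\neq x$ for all $t$ close to $\gamma^{-1}$, so there $u(t,x)$ is the value of the density part. *)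

(* Defs.v *)
From HB Require Import structures.
From mathcomp Require Import all_boot all_order all_algebra.
From mathcomp Require Import complex.
From mathcomp Require Import all_classical all_reals all_analysis.
From mathcomp Require Import measurable_realfun.

Set Implicit Arguments.
Unset Strict Implicit.
Unset Printing Implicit Defensive.

Import Order.TTheory GRing.Theory Num.Theory.
Import numFieldNormedType.Exports.

Local Open Scope classical_set_scope.
Local Open Scope complex_scope.
Local Open Scope ring_scope.

(* The norm topology on the complex numbers: the library puts it on [R[i]^o]. *)
HB.instance Definition _ (R : realType) := NormedModule.copy R[i] R[i]^o.

Section complex_functions.
Context {R : realType}.
Implicit Types a b c w z : R[i].

Definition gauss_term a b c z (n : nat) : R[i] :=
  (\prod_(k < n) (a + k%:R)) * (\prod_(k < n) (b + k%:R)) /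
  ((\prod_(k < n) (c + k%:R)) * n`!%:R) * z ^+ n.

Definition gauss_series a b c z : R[i] :=
  lim (series (gauss_term a b c z) @ \oo).

(* In the order of [R[i]], [1 <= w] says that [w] is real and at least 1, so
   [~~ (1 <= w)] is the slit plane. *)
Definition continues_gauss_series a b c (G : R[i] -> R[i]) : Prop :=
  (forall w, ~~ (1 <= w) -> derivable G w 1) /\
  (forall w, `|w| < 1 -> G w = gauss_series a b c w).

(* Principal branch of 2F1(a, b; c; z): the Gauss series on the unit disc, and
   its holomorphic continuation (unique, the slit plane being connected) on the
   rest of the slit plane. *)
Definition hyp2F1 a b c z : R[i] :=
  if `|z| < 1 then gauss_series a b c z
  else xget (fun=> 0) [set G | continues_gauss_series a b c G] z.

(* [s] raised to the complex power [z], for [0 < s]. *)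
Definition cpowR (s : R) z : R[i] :=
  (s `^ complex.Re z)%:C *
  (cos (complex.Im z * ln s) +i* sin (complex.Im z * ln s)).

(* Euler's integral; it represents Gamma for [0 < Re z] only. *)
Definition Gamma z : R[i] :=
  let f (s : R) := cpowR s (z - 1) * (expR (- s))%:C in
  (\int[lebesgue_measure]_(s in `]0, +oo[) complex.Re (f s)) +i*
  (\int[lebesgue_measure]_(s in `]0, +oo[) complex.Im (f s)).

End complex_functions.

Section density_measure.
Context {R : realType}.
Implicit Type f : R -> R[i].

(* In the order of [R[i]], [0 <= f x] says that [f x] is real and
   nonnegative. *)
Definition is_density f : Prop :=
  measurable_fun (`]0, +oo[ : set R) (fun x => complex.Re (f x)) /\
  (forall x, 0 < x -> 0 <= f x).

(* The guard makes [density_measure f] a measure for every [f]. *)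
Definition density_fun f (x : R) : R :=
  if `[< is_density f >] && (0 < x) then complex.Re (f x) else 0.

Lemma density_fun_ge0 f x : 0 <= density_fun f x.
Proof.
rewrite /density_fun; case: asboolP => //= -[_ f0].
by case: ifPn => // x0; move: (f0 x x0); rewrite lecE => /andP[].
Qed.

Lemma measurable_density_fun f : measurable_fun setT (density_fun f).
Proof.
case: (asboolP (is_density f)) => hf; last first.
  rewrite (_ : density_fun f = cst 0)//; apply/funext => x.
  by rewrite /density_fun; case: asboolP.
rewrite (_ : density_fun f =
  (fun x => complex.Re (f x)) \_ (`]0, +oo[ : set R)).
  by apply/(measurable_restrictT _ _).1 => //; exact: hf.1.
apply/funext => x; rewrite /density_fun patchE; case: asboolP => //= _.
by rewrite mem_setE in_itv/= andbT.
Qed.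

(* The measure with density [f] on the positive half-line. *)
Definition density_measure f (A : set (measurableTypeR R)) : \bar R :=
  \int[lebesgue_measure]_(x in A) (density_fun f x)%:E.

Let density_measure0 f : density_measure f set0 = 0%E.
Proof. by rewrite /density_measure integral_set0. Qed.

Let density_measure_ge0 f A : (0 <= density_measure f A)%E.
Proof.
by apply: integral_ge0 => x _; rewrite lee_fin density_fun_ge0.
Qed.

Let density_measure_sigma_additive f : semi_sigma_additive (density_measure f).
Proof.
apply: (@semi_sigma_additive_nng_induced _ _ _ lebesgue_measure
  (EFin \o density_fun f)).
- by apply/measurable_EFinP; exact: measurable_density_fun.
- by move=> x; rewrite lee_fin density_fun_ge0.
Qed.

HB.instance Definition _ f := isMeasure.Build _ _ _ (density_measure f)
  (density_measure0 f) (density_measure_ge0 f)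
  (@density_measure_sigma_additive f).

End density_measure.

Section solution.
Context {R : realType}.
Implicit Types gamma theta t x : R.

Definition sigma1 theta : R[i] := 1 - sqrtC (1 - theta)%:C.
Definition sigma2 theta : R[i] := 1 + sqrtC (1 - theta)%:C.

(* The value at 0 only affects the density below at one point. *)
Definition heaviside x : R := if 0 < x then 1 else 0.

Definition u_density gamma theta t x : R[i] :=
  (theta * (1 - gamma * t) `^ (2 / gamma) * t)%:C *
  hyp2F1 (1 + sigma1 theta / gamma%:C) (1 + sigma2 theta / gamma%:C) 2
    (gamma * t * (1 + (gamma * t - 1) * x `^ gamma))%:C *
  (heaviside (1 - (1 - gamma * t) `^ gamma^-1 * x))%:C.

(* For [0 < gamma], [1 < theta] and [0 < t < gamma^-1] the guard in
   [density_measure] holds: the two upper parameters of [hyp2F1] are complex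
   conjugate, so the coefficients of the Gauss series are nonnegative reals,
   and its argument lies in ]0, 1[ wherever the Heaviside factor is nonzero. *)
Definition u_measure gamma theta t : {measure set (measurableTypeR R) -> \bar R} :=
  measure_add
    (mscale (NngNum (powR_ge0 (1 - gamma * t) gamma^-1))
       (dirac ((1 - gamma * t) `^ (- gamma^-1) : measurableTypeR R)))
    (density_measure (u_density gamma theta t)).

End solution.

(* Main.v *)
(* With x = 1/gamma, alpha = sigma_2/gamma = x + iy and e = 1 - gamma t, expanding
   the density in its Gauss series and integrating term by term, with
     int_0^N s^r (1 - (s/N)^gamma)^n ds = N^(r+1) n! / (gamma (p)_(n+1)),
   p = (r + 1)/gamma, N = e^(-1/gamma), shows that the r-th moment of u is exactly
     e^((1-r)/gamma) 2F1(alpha, conj alpha; p; 1 - e),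
   the Dirac mass being the constant term of the series.  So everything is about
   power series with nonnegative coefficients as z -> 1.  The integral above, for a
   complex exponent and gamma = 1, tends to Euler's integral and gives Euler's
   product formula for |Gamma(alpha)|^2 and for real Gamma values; hence the
   coefficients are asymptotic to multiples of those of (1 - z)^(-q) or of
   -log(1 - z), and an Abelian argument gives the pointwise limit, (ii) and (iii).
   For (i) the series converges at 1, and its sum is computed as Gauss did, by
   iterating the contiguous relation between p and p + 1. *)
Require Import Defs.
From mathcomp Require Import all_boot all_order all_algebra.
From mathcomp Require Import complex.
From mathcomp Require Import all_classical all_reals all_analysis.
From mathcomp Require Import measurable_realfun.
From mathcomp Require Import ring lra zify.

Set Implicit Arguments.
Unset Strict Implicit.
Unset Printing Implicit Defensive.

Import Order.TTheory GRing.Theory Num.Theory.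
Import numFieldNormedType.Exports.

Local Open Scope classical_set_scope.
Local Open Scope complex_scope.
Local Open Scope ring_scope.

(** * Integrals of complex powers *)

Section power_integrals.
Context {R : realType}.
Local Notation mu := (@lebesgue_measure R).
Implicit Types (f F : R -> R) (N s g : R) (c al : R[i]) (n : nat).

(** Conjugacy of the two upper parameters makes the problem real: their Pochhammer symbols multiply
    to |(alpha)_n|^2 ([sqpoch]) and their Gamma factors to |Gamma(alpha)|^2 ([sqnorm]). Stirling's
    formula is avoided: a ratio of coefficients is a quotient of Euler products taken at the same n,
    in which the powers of n cancel because the lower parameters add up to 2x. The price is that
    |Gamma(alpha)|^2 must be shown to be nonzero, which a limit of positive terms does not give; a
    bound of |(alpha)_n|^2 by a constant times (x)_n^2 does. The critical case is p = 2x, that is r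
    = 1. For p < 2x the singularity at 1 has order 2x - p = (1-r)/gamma, exactly the exponent of e
    in the moment; for p > 2x the prefactor in (i) cancels that power of e and the value of the
    series at 1 remains. In the pointwise limit, with the argument written z, 1 - z = (1 - gamma
    t)(1 + gamma t x^gamma), so the factor (1 - gamma t)^(2/gamma) compensates a singularity of
    order 2x = 2/gamma and leaves the profile in x. Nonnegativity of all terms justifies every
    exchange of sum and integral. *)

Lemma ge0_integral_itv_oc0 f F N : 0 < N ->
  (forall s, 0 < s <= N -> 0 <= f s) ->
  (forall s, 0 < s <= N -> is_derive s 1 F (f s)) ->
  (forall s, 0 < s <= N -> {for s, continuous f}) ->
  F s @[s --> 0^'+] --> 0 ->
  (\int[mu]_(s in `]0%R, N]) (f s)%:E = (F N)%:E)%E.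
Proof.
move=> N0 f0 dF cf F0.
(* [f] may be unbounded at 0, so the fundamental theorem of calculus is applied on these intervals,
   and nonnegativity lets the integrals increase to the one over ]0, N]. The offset 2 keeps the left
   endpoint strictly below [N]. *)
pose I (i : nat) : set R := `[N / i.+2%:R, N]%classic.
have Ipos i : 0 < N / i.+2%:R by rewrite divr_gt0.
have IltN i : N / i.+2%:R < N by rewrite ltr_pdivrMr// ltr_pMr// ltr1n.
have cvgI : N / i.+2%:R @[i --> \oo] --> (0 : R).
  have : N * (i.+2%:R)^-1 @[i --> \oo] --> N * (0 : R).
    apply: cvgM; first exact: cvg_cst.
    by have := @cvg_harmonic R; rewrite -cvg_shiftS.
  by rewrite mulr0.
have -> : `]0, N]%classic = \bigcup_i I i.
  apply/seteqP; split => s /=; rewrite in_itv/=.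
    move=> /andP[s0 sN].
    have [i _ hi] : \forall i \near \oo, N / i.+2%:R < s.
      have /cvgrPdist_lt /(_ _ s0) := cvgI.
      apply: filterS => i; rewrite sub0r normrN ger0_norm//.
      exact/ltW.
    exists i => //; rewrite /I /= in_itv/= sN andbT ltW//; exact: (hi i (leqnn i)).
  move=> [i _]; rewrite /I /= in_itv/= => /andP[h ->]; rewrite andbT.
  exact: lt_le_trans h.
have cI i : {within I i, continuous f}.
  apply: continuous_in_subspaceT => s; rewrite inE /I /= in_itv/= => /andP[h sN].
  by apply: cf; rewrite sN andbT; exact: lt_le_trans h.
have intI i : (\int[mu]_(s in I i) (f s)%:E = (F N - F (N / i.+2%:R))%:E)%E.
  have pos s : s \in `]N / i.+2%:R, N[ -> 0 < s <= N.
    by rewrite in_itv/= => /andP[h /ltW ->]; rewrite andbT; exact: lt_trans h.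
  have dc s : 0 < s <= N -> {for s, continuous F}.
    move=> s0; apply: differentiable_continuous; apply/derivable1_diffP.
    by have [] := dF s s0.
  rewrite EFinB; apply: (@continuous_FTC2 _ f F _ _ (IltN i) (cI i)).
    split.
    - by move=> s /pos/dF[].
    - by apply: cvg_at_right_filter; apply: dc; rewrite Ipos/= ltW.
    - by apply: cvg_at_left_filter; apply: dc; rewrite N0/=.
  by move=> s /pos/dF dFs; rewrite derive1E derive_val.
have H1 : (\int[mu]_(s in I i) (f s)%:E @[i --> \oo] -->
    \int[mu]_(s in \bigcup_i I i) (f s)%:E)%E.
  apply: ge0_nondecreasing_set_cvg_integral.
  - move=> i j ij; apply/subsetPset => s; rewrite /I /= !in_itv/=.
    move=> /andP[h ->]; rewrite andbT (le_trans _ h)// ler_pM2l//.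
    by rewrite lef_pV2 ?posrE// ler_nat.
  - by move=> i; exact: measurable_itv.
  - move=> i; apply/measurable_EFinP.
    by apply: subspace_continuous_measurable_fun => //; exact: measurable_itv.
  - move=> i s; rewrite /I /= in_itv/= lee_fin => /andP[h sN].
    by apply: f0; rewrite sN andbT; exact: lt_le_trans h.
suff H2 : (\int[mu]_(s in I i) (f s)%:E @[i --> \oo] --> (F N)%:E)%E.
  by rewrite -(cvg_lim _ H1)// (cvg_lim _ H2).
under eq_fun do rewrite intI.
apply: cvg_EFin; first exact: nearW.
rewrite -[X in _ --> X]subr0.
apply: cvgB; first exact: cvg_cst.
by move/cvg_at_rightP : F0; apply; split.
Qed.

(** An arbitrary complex factor [c] lets one real-valued statement serve both parts of a complex
    integral ([c = 1] and [c = -i]); it also absorbs the complex constants that integration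
    produces. *)
Lemma Re_mul_cpowR c al s : complex.Re (c * cpowR s al) =
  s `^ complex.Re al * (complex.Re c * cos (complex.Im al * ln s) -
                        complex.Im c * sin (complex.Im al * ln s)).
Proof. by case: c al => [c1 c2] [x y]; rewrite /cpowR/=; ring. Qed.

Lemma is_derive_Re_cpowR c al s : 0 < s ->
  is_derive s 1 (fun s => complex.Re (c * cpowR s al))
    (complex.Re (c * al * cpowR s (al - 1))).
Proof.
move=> s0.
under eq_fun do rewrite Re_mul_cpowR.
case: c al => [c1 c2] [x y].
have ds := is_derive1_ln s0.
have dp := is_derive1_powR x s0.
apply: is_derive_eq.
rewrite /GRing.scale/= oppr0 !addr0.
have -> : s `^ (x - 1) = s `^ x / s.
  by rewrite powRB ?powRr1 ?(gt_eqF s0) ?implybT// ltW.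
by field; rewrite gt_eqF.
Qed.

Lemma continuous_Re_cpowR c al s : 0 < s ->
  {for s, continuous (fun s => complex.Re (c * cpowR s al))}.
Proof.
move=> s0; apply: differentiable_continuous; apply/derivable1_diffP.
by have [] := is_derive_Re_cpowR c al s0.
Qed.

Lemma normr_Re_mul_cpowR c al s : `|complex.Re (c * cpowR s al)| <=
  (`|complex.Re c| + `|complex.Im c|) * s `^ complex.Re al.
Proof.
rewrite Re_mul_cpowR normrM [leRHS]mulrC (ger0_norm (powR_ge0 _ _)).
rewrite ler_wpM2l ?powR_ge0// (le_trans (ler_normB _ _))//.
by rewrite !normrM lerD// ler_piMr// ?cos_max// sin_max.
Qed.

Lemma Re_cpowR_cvg0 c al : 0 < complex.Re al ->
  complex.Re (c * cpowR s al) @[s --> 0^'+] --> 0.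
Proof.
move=> al0; apply/norm_cvg0P.
set M := `|complex.Re c| + `|complex.Im c|.
have h : M * s `^ complex.Re al @[s --> 0^'+] --> 0.
  by rewrite -[X in _ --> X](mulr0 M); apply: cvgMr; exact: powR_cvg0.
apply: (squeeze_cvgr _ (cvg_cst 0) h).
by near=> s; rewrite normr_ge0/= normr_Re_mul_cpowR.
Unshelve. all: by end_near. Qed.

(** The oscillating integrand is dominated by [M * s ^ (x - 1)], where x = Re al > 0, and the
    integral of this majorant over ]0, N] is elementary. *)
Lemma integral_Re_cpowR c al N : 0 < N -> 0 < complex.Re al ->
  mu.-integrable `]0, N] (fun s => (complex.Re (c * al * cpowR s (al - 1)))%:E)
  /\ (\int[mu]_(s in `]0%R, N]) (complex.Re (c * al * cpowR s (al - 1)))%:E =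
     (complex.Re (c * cpowR N al))%:E)%E.
Proof.
move=> N0 al0; set x := complex.Re al.
pose M := `|complex.Re (c * al)| + `|complex.Im (c * al)|.
pose f s := complex.Re (c * al * cpowR s (al - 1)).
pose g s := M * s `^ (x - 1).
have M0 : 0 <= M by rewrite addr_ge0.
have fg s : `|f s| <= g s.
  rewrite (le_trans (normr_Re_mul_cpowR _ _ _))//.
  by have -> : complex.Re (al - 1) = x - 1 by rewrite /x; case: (al).
have g0 s : 0 <= g s by rewrite mulr_ge0// powR_ge0.
have dg s : 0 < s -> is_derive s 1 (fun s => M / x * s `^ x) (g s).
  move=> s0; have ds := is_derive1_powR x s0; apply: is_derive_eq.
  by rewrite /GRing.scale/= mulrA divfK// gt_eqF.
have cg s : 0 < s -> {for s, continuous g}.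
  move=> s0; apply: differentiable_continuous; apply/derivable1_diffP.
  have ds := is_derive1_powR (x - 1) s0.
  by apply: ex_derive.
have mI (h : R -> R) : (forall s, 0 < s -> {for s, continuous h}) ->
    measurable_fun (`]0, N] : set R) (EFin \o h).
  move=> ch; apply/measurable_EFinP.
  apply: subspace_continuous_measurable_fun => //.
  apply: continuous_in_subspaceT => s; rewrite inE /= in_itv/= => /andP[h0 _].
  exact: ch.
have cf s : 0 < s -> {for s, continuous f} by exact: continuous_Re_cpowR.
have h0 : M / x * s `^ x @[s --> 0^'+] --> 0.
  by rewrite -[X in _ --> X](mulr0 (M / x)); apply: cvgMr; exact: powR_cvg0.
have Ig : (\int[mu]_(s in `]0%R, N]) (g s)%:E = (M / x * N `^ x)%:E)%E.
  by apply: (ge0_integral_itv_oc0 N0 (fun s _ => g0 s) _ _ h0) => s /andP[s0 _];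
    [exact: dg|exact: cg].
have ig : mu.-integrable `]0, N] (EFin \o g).
  apply/integrableP; split; first exact: mI.
  under eq_integral do rewrite /= ger0_norm//.
  by rewrite Ig ltry.
have if_ : mu.-integrable `]0, N] (EFin \o f).
  apply: (le_integrable _ _ _ ig) => //; first exact: mI.
  by move=> s _ /=; rewrite lee_fin (ger0_norm (g0 s)).
split => //.
(* [f] has no sign, but [f + g] is nonnegative and has an antiderivative. *)
have Ifg : (\int[mu]_(s in `]0%R, N]) (f s + g s)%:E =
    (complex.Re (c * cpowR N al) + M / x * N `^ x)%:E)%E.
  apply: (@ge0_integral_itv_oc0 _
    (fun s => complex.Re (c * cpowR s al) + M / x * s `^ x)) => //.
  - by move=> s _; rewrite -lerBlDr sub0r; have := fg s; rewrite ler_norml => /andP[].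
  - move=> s /andP[s0 _]; have d1 := is_derive_Re_cpowR c al s0; have d2 := dg _ s0.
    exact: is_deriveD.
  - by move=> s /andP[s0 _]; apply: continuousD; [exact: cf|exact: cg].
  - by rewrite -[X in _ --> X](addr0 0); apply: cvgD => //; exact: Re_cpowR_cvg0.
have : (\int[mu]_(s in `]0%R, N]) (f s + g s)%:E =
    \int[mu]_(s in `]0%R, N]) (f s)%:E + \int[mu]_(s in `]0%R, N]) (g s)%:E)%E.
  by rewrite integralD_EFin.
rewrite Ifg Ig EFinD => /eqP; rewrite eq_sym => /eqP/(congr1 (fun z => z - (M / x * N `^ x)%:E)%E).
by rewrite !addeK.
Qed.

Lemma prodrD_shift (a b : R[i]) n :
  \prod_(k < n.+1) (a + k%:R * b) = a * \prod_(k < n) (a + b + k%:R * b).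
Proof.
rewrite big_ord_recl mul0r addr0; congr (_ * _); apply: eq_bigr => k _.
by rewrite /bump/= natrD mulrDl mul1r addrA.
Qed.

Lemma Re_gt0_neq0 (z : R[i]) : 0 < complex.Re z -> z != 0.
Proof. by apply: contraTneq => ->; rewrite ltxx. Qed.

Lemma ReD_natM (a : R[i]) g n :
  complex.Re (a + n%:R * g%:C) = complex.Re a + n%:R * g.
Proof.
by rewrite !mulr_natl -(rmorphMn (real_complex R)); case: a => x y /=.
Qed.

Lemma cpowRDr al g N : 0 < N -> cpowR N (al + g%:C) = cpowR N al * (N `^ g)%:C.
Proof.
move=> N0; case: al => a b; rewrite /cpowR/= addr0.
rewrite powRD; last by rewrite (gt_eqF N0) implybT.
by rewrite rmorphM -!mulrA; congr (_ * _); rewrite mulrC.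
Qed.

(** A Beta integral with an integer argument, by induction on [n] for all [c] and [al] at once. With
    v = (s/N)^g, (1 - v)^(n+1) = (1 - v)^n - v (1 - v)^n, and the factor v turns [al] into [al + g]
    and [c] into c N^(-g). *)
Lemma integral_Re_cpowR_onem c al g N n : 0 < N -> 0 < g ->
  0 < complex.Re al ->
  mu.-integrable `]0, N] (fun s =>
    (complex.Re (c * cpowR s (al - 1)) * (1 - (s / N) `^ g) ^+ n)%:E) /\
  (\int[mu]_(s in `]0%R, N])
    (complex.Re (c * cpowR s (al - 1)) * (1 - (s / N) `^ g) ^+ n)%:E =
    (complex.Re (c * cpowR N al * (n`!%:R * g%:C ^+ n) /
      \prod_(k < n.+1) (al + k%:R * g%:C)))%:E)%E.
Proof.
move=> N0 g0; elim: n c al => [|n IH] c al al0.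
  have al_neq0 := Re_gt0_neq0 al0.
  have [] := integral_Re_cpowR (c / al) N0 al0; rewrite divfK// => i1 e1.
  split.
    by apply: eq_integrable i1 => // s _; rewrite expr0 mulr1.
  under eq_integral do rewrite expr0 mulr1.
  rewrite e1 big_ord_recl big_ord0 mul0r addr0 expr0 !mulr1.
  by congr (complex.Re _)%:E; rewrite mulrAC.
have alg0 : 0 < complex.Re (al + g%:C) by case: (al) al0 => a b /= a0; rewrite addr_gt0.
have [i1 e1] := IH c al al0.
have [i2 e2] := IH (c * (N `^ (- g))%:C) _ alg0.
have E s : s \in `]0, N]%classic ->
    (complex.Re (c * cpowR s (al - 1)) * (1 - (s / N) `^ g) ^+ n.+1)%:E =
    ((complex.Re (c * cpowR s (al - 1)) * (1 - (s / N) `^ g) ^+ n)%:E -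
    (complex.Re (c * (N `^ (- g))%:C * cpowR s (al + g%:C - 1)) *
      (1 - (s / N) `^ g) ^+ n)%:E)%E.
  rewrite inE /= in_itv/= => /andP[s0 _].
  rewrite -EFinB; congr EFin.
  have -> : al + g%:C - 1 = al - 1 + g%:C by ring.
  rewrite cpowRDr//.
  have -> : c * (N `^ (- g))%:C * (cpowR s (al - 1) * (s `^ g)%:C) =
     c * cpowR s (al - 1) * ((s / N) `^ g)%:C.
    rewrite powRM ?invr_ge0 ?ltW// -powR_inv1 ?ltW// -powRrM mulN1r rmorphM.
    by ring.
  have -> z (a : R) : complex.Re (z * a%:C) = complex.Re z * a.
    by case: z => z1 z2 /=; ring.
  by rewrite exprS; ring.
split.
  apply: eq_integrable (integrableB _ i1 i2) => //.
  by move=> s /E ->.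
under eq_integral => s sI do rewrite (E s sI).
rewrite integralB// e1 e2 -EFinB; congr EFin.
rewrite -raddfB/=; congr complex.Re.
rewrite cpowRDr// powRN rmorphV/=; last by rewrite unitfE gt_eqF// powR_gt0.
have Ng0 : (N `^ g)%:C != 0 by apply: Re_gt0_neq0; rewrite /= powR_gt0.
set P := \prod_(k < n) (al + g%:C + k%:R * g%:C).
have P0 : P != 0.
  apply/prodf_neq0 => k _; apply: Re_gt0_neq0.
  by rewrite ReD_natM ltr_wpDr// mulr_ge0// ltW.
have E1 : \prod_(k < n.+1) (al + k%:R * g%:C) = al * P by rewrite prodrD_shift.
have E2 : \prod_(k < n.+1) (al + g%:C + k%:R * g%:C) =
  P * (al + g%:C + n%:R * g%:C) by rewrite big_ord_recr.
have E3 : \prod_(k < n.+2) (al + k%:R * g%:C) =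
   al * (P * (al + g%:C + n%:R * g%:C)) by rewrite prodrD_shift E2.
rewrite E1 E2 E3 factS natrM exprS -[n.+1]addn1 natrD.
have al_neq0 := Re_gt0_neq0 al0.
have aln0 : al + g%:C + n%:R * g%:C != 0.
  by apply: Re_gt0_neq0; rewrite ReD_natM ltr_wpDr// mulr_ge0// ltW.
field.
by rewrite P0 al_neq0 aln0 Ng0.
Qed.

End power_integrals.

(** * Euler's limit formula *)

Section gamma_limit.
Context {R : realType}.
Local Notation mu := (@lebesgue_measure R).
Local Notation Rp := (`]0%R, +oo[%classic : set R).
Implicit Types (f : R -> R) (s k x : R) (c al : R[i]) (n : nat).

Lemma gt0_continuous_measurable f : (forall s, 0 < s -> {for s, continuous f}) ->
  measurable_fun Rp f.
Proof.
move=> cf; apply: open_continuous_measurable_fun; first exact: interval_open.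
by move=> s; rewrite inE /= in_itv/= andbT; exact: cf.
Qed.

Lemma bigcup_itv_oc0 : Rp = \bigcup_n `]0%R, n.+1%:R : R]%classic.
Proof.
apply/seteqP; split => s /=; rewrite in_itv/=.
  rewrite andbT => s0; exists (Num.bound s) => //=; rewrite in_itv/= s0/=.
  rewrite (le_trans (ltW (archi_boundP (ltW s0))))// ler_nat//.
by move=> [n _] /=; rewrite in_itv/= andbT => /andP[].
Qed.

(** Origin of the majorant used for Gamma integrals: this derivative behaves like s^(x-1) at 0 and
    like s^(-2) at infinity, and its antiderivative is bounded by 1/x, so integrability on the whole
    half-line comes without splitting it. *)
Lemma powR_ratio_derive x s : 0 < x -> 0 < s ->
  is_derive s 1 (fun s => (s / (1 + s)) `^ x / x)
    (s `^ (x - 1) * (1 + s) `^ (- (x + 1))).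
Proof.
move=> x0 s0.
have s1 : 0 < 1 + s by rewrite addr_gt0.
have s1' : 1 + s != 0 by rewrite gt_eqF.
have q0 : 0 < s / (1 + s) by rewrite divr_gt0.
have dq : is_derive s 1 (fun s => s / (1 + s)) ((1 + s)^-1 ^+ 2).
  by apply: is_derive_eq; rewrite /GRing.scale/=; field.
have dp := is_derive1_powR x q0.
have dd := @is_derive1_comp _ (@powR R ^~ x) (fun s => s / (1 + s)) _ _ _ dp dq.
have -> : (fun s => (s / (1 + s)) `^ x / x) =
   (x^-1 \*: ((@powR R ^~ x) \o (fun s => s / (1 + s)))).
  by apply/funext => z /=; rewrite /GRing.scale/= mulrC.
apply: is_derive_eq.
rewrite /GRing.scale/= -[x * _ * _]mulrA mulKf ?gt_eqF//.
rewrite powRM ?invr_ge0 ?ltW// -mulrA; congr (_ * _).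
have -> : (1 + s)^-1 `^ (x - 1) = (1 + s) `^ (- (x - 1)).
  by rewrite -powR_inv1 ?ltW// -powRrM mulN1r.
have -> : (1 + s)^-1 ^+ 2 = (1 + s) `^ (- 2%:R) by rewrite powR_invn ?ltW// exprVn.
rewrite -powRD; last by rewrite s1' implybT.
by congr (_ `^ _); ring.
Qed.

Lemma integrable_powR_ratio x : 0 < x ->
  mu.-integrable Rp (fun s => (s `^ (x - 1) * (1 + s) `^ (- (x + 1)))%:E).
Proof.
move=> x0; pose h s := s `^ (x - 1) * (1 + s) `^ (- (x + 1)).
have h0 s : 0 <= h s by rewrite mulr_ge0// powR_ge0.
have dh s : 0 < s -> is_derive s 1 (fun s => (s / (1 + s)) `^ x / x) (h s).
  by move=> s0; exact: powR_ratio_derive.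
have ch s : 0 < s -> {for s, continuous h}.
  move=> s0; have s1 : 0 < 1 + s by rewrite addr_gt0.
  apply: differentiable_continuous; apply/derivable1_diffP.
  have d1 := is_derive1_powR (x - 1) s0.
  have d2 := is_derive1_powR (- (x + 1)) s1.
  have d3 : is_derive s 1 (fun s => 1 + s) 1.
    by apply: is_derive_eq; rewrite add0r mul1r.
  have d4 := @is_derive1_comp _ (@powR R ^~ (- (x + 1))) (fun s => 1 + s) _ _ _ d2 d3.
  exact: (@ex_derive _ _ _ _ _ _ _ (is_deriveM d1 d4)).
have F0 : (s / (1 + s)) `^ x / x @[s --> 0^'+] --> 0.
  apply: (squeeze_cvgr _ (cvg_cst 0) (_ : s `^ x / x @[s --> 0^'+] --> 0)).
    near=> s; have s0 : 0 < s by [].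
    apply/andP; split; first by rewrite mulr_ge0 ?powR_ge0 ?invr_ge0 ?ltW.
    rewrite ler_wpM2r ?invr_ge0 ?(ltW x0)//.
    have s1 : 0 < 1 + s by rewrite addr_gt0.
    apply: ge0_ler_powR; rewrite ?nnegrE ?divr_ge0 ?(ltW x0) ?(ltW s0) ?(ltW s1)//.
    by rewrite ler_pdivrMr// ler_pMr// lerDl (ltW s0).
  by rewrite -[X in _ --> X](mul0r x^-1); apply: cvgMl; exact: powR_cvg0.
have mh : measurable_fun Rp (EFin \o h).
  by apply/measurable_EFinP; exact: gt0_continuous_measurable.
suff ih : mu.-integrable Rp (EFin \o h) by [].
apply/integrableP; split => //.
under eq_integral do rewrite /= (ger0_norm (h0 _)).
rewrite bigcup_itv_oc0.
have : (\int[mu]_(s in `]0%R, n.+1%:R]) (h s)%:E @[n --> \oo] -->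
    \int[mu]_(s in \bigcup_n `]0%R, n.+1%:R]%classic) (h s)%:E)%E.
  apply: ge0_nondecreasing_set_cvg_integral.
  - move=> i j ij; apply/subsetPset => s /=; rewrite !in_itv/=.
    by move=> /andP[-> h1] /=; rewrite (le_trans h1)// ler_nat.
  - by move=> i; exact: measurable_itv.
  - move=> i; apply: measurable_funS mh => // s /=; rewrite !in_itv/=.
    by move=> /andP[->].
  - by move=> i s _; rewrite lee_fin.
move/cvg_lim => <- //.
apply: (@le_lt_trans _ _ (x^-1)%:E); last exact: ltry.
apply: lime_le.
  apply/ereal_nondecreasing_is_cvgn => i j ij; apply: ge0_subset_integral => //.
  - apply: measurable_funS mh => // s /=; rewrite !in_itv/=.
    by move=> /andP[->].
  - by move=> s _; rewrite lee_fin.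
  - move=> s /=; rewrite !in_itv/=.
    by move=> /andP[-> h1] /=; rewrite (le_trans h1)// ler_nat.
apply: nearW => n.
have -> : (\int[mu]_(s in `]0%R, n.+1%:R]) (h s)%:E =
    ((n.+1%:R / (1 + n.+1%:R)) `^ x / x)%:E)%E.
  by apply: (ge0_integral_itv_oc0 _ (fun s _ => h0 s) _ _ F0) => // s /andP[s0 _];
    [exact: dh|exact: ch].
rewrite lee_fin ler_piMl ?invr_ge0 ?(ltW x0)//.
rewrite [leRHS](_ : 1 = 1 `^ x); last by rewrite powR1.
apply: ge0_ler_powR; rewrite ?nnegrE ?divr_ge0 ?(ltW x0)//.
by rewrite ler_pdivrMr// mul1r lerDr.
Unshelve. all: by end_near. Qed.

(** Apply ln v <= v at v = d (1 + s). The choice d = k/(x+1) makes (x+1) d (1 + s) equal to k (1 +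
    s), so the terms in s cancel and the constant left over is the logarithm of [C]. *)
Lemma powR_expR_bound x k : 0 < x -> 0 < k -> exists2 C, 0 < C &
  forall s, 0 < s -> s `^ (x - 1) * expR (- (k * s)) <=
    C * (s `^ (x - 1) * (1 + s) `^ (- (x + 1))).
Proof.
move=> x0 k0; pose d := k / (x + 1).
have x1 : 0 < x + 1 by rewrite addr_gt0.
have d0 : 0 < d by rewrite divr_gt0.
exists (expR (k - (x + 1) * ln d)); first exact: expR_gt0.
move=> s s0; have s1 : 0 < 1 + s by rewrite addr_gt0.
rewrite mulrCA ler_wpM2l ?powR_ge0//.
have -> : (1 + s) `^ (- (x + 1)) = expR (- (x + 1) * ln (1 + s)).
  by rewrite /powR gt_eqF.
rewrite -expRD ler_expR.
have h : ln (1 + s) <= d * (1 + s) - ln d.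
  by rewrite lerBrDr -lnM ?posrE// mulrC ltW// ln_sublinear// mulr_gt0.
have : (x + 1) * ln (1 + s) <= (x + 1) * (d * (1 + s) - ln d).
  by rewrite ler_pM2l.
have -> : (x + 1) * (d * (1 + s) - ln d) = k * (1 + s) - (x + 1) * ln d.
  by rewrite /d; field; rewrite gt_eqF.
by lra.
Qed.

Lemma measurable_expRNM k : measurable_fun setT (fun s => expR (- (k * s))).
Proof.
apply: measurableT_comp => //; apply: measurable_funN; exact: measurable_funM.
Qed.

Lemma integrable_powR_expR x k : 0 < x -> 0 < k ->
  mu.-integrable Rp (fun s => (s `^ (x - 1) * expR (- (k * s)))%:E).
Proof.
move=> x0 k0; have [C C0 hC] := powR_expR_bound x0 k0.
apply: le_integrable (integrableZl _ C (integrable_powR_ratio x0)) => //.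
  apply/measurable_EFinP; apply: measurable_funM.
    by apply: measurable_funTS; exact: measurable_powR.
  by apply: measurable_funTS; exact: measurable_expRNM.
move=> s /=; rewrite in_itv/= andbT => s0.
rewrite lee_fin !ger0_norm ?hC// ?mulr_ge0 ?powR_ge0 ?expR_ge0//.
exact: ltW.
Qed.

Lemma Bernoulli_le x n : x <= 1 -> 1 - n%:R * x <= (1 - x) ^+ n.
Proof.
move=> x1; elim: n => [|n IH]; first by rewrite mul0r subr0 expr0.
have [h|h] := leP 0 (1 - n%:R * x).
  rewrite exprS (le_trans _ (ler_wpM2l _ IH)) ?subr_ge0//.
  rewrite -[n.+1]addn1 natrD -subr_ge0.
  have -> : (1 - x) * (1 - n%:R * x) - (1 - (n%:R + 1) * x) = n%:R * x ^+ 2.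
    by ring.
  by rewrite mulr_ge0// sqr_ge0.
rewrite (@le_trans _ _ 0) ?exprn_ge0 ?subr_ge0//.
have x0 : 0 <= x.
  rewrite leNgt; apply/negP => xn; move: h; rewrite subr_lt0 => h.
  have : 1 < (0:R) by rewrite (lt_le_trans h)// mulr_ge0_le0// ltW.
  by rewrite ltr10.
by rewrite -[n.+1]addn1 natrD mulrDl opprD addrA (le_trans _ (ltW h))// mul1r gerBl.
Qed.

(** With m = n + 1, the function (1 - ks/m)^m on ]0, m/k] extended by zero, so that dominated
    convergence runs over a fixed domain. The exponent m is positive, hence the power does vanish
    where the maximum is 0. *)
Definition expR_trunc k n s : R := Num.max 0 (1 - k * s / n.+1%:R) ^+ n.+1.

Lemma expR_trunc_ge0 k n s : 0 <= expR_trunc k n s.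
Proof. by rewrite exprn_ge0// le_max lexx. Qed.

Lemma expR_trunc_le k n s : expR_trunc k n s <= expR (- (k * s)).
Proof.
rewrite /expR_trunc.
have -> : - (k * s) = n.+1%:R * (- (k * s / n.+1%:R)) by field.
rewrite expRM_natl lerXn2r ?nnegrE ?expR_ge0 ?le_max ?lexx//.
by rewrite ge_max expR_ge0 expR_ge1Dx.
Qed.

(** With u = ks, m = n + 1 and v = u/m, (1 - v)^m = e^(-u) (e^v (1 - v))^m. Since e^v >= 1 + v, the
    last base is at least 1 - v^2, and Bernoulli's inequality bounds its power below by 1 - m v^2 =
    1 - u^2/m. *)
Lemma expR_trunc_cvg k s : expR_trunc k n s @[n --> \oo] --> expR (- (k * s)).
Proof.
set u := k * s.
have h : expR (- u) * (1 - u ^+ 2 / n.+1%:R) @[n --> \oo] --> expR (- u).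
  rewrite -[X in _ --> X]mulr1; apply: cvgM; first exact: cvg_cst.
  rewrite -[X in _ --> X]subr0; apply: cvgB; first exact: cvg_cst.
  rewrite -[X in _ --> X](mulr0 (u ^+ 2)); apply: cvgM; first exact: cvg_cst.
  exact: cvg_harmonic.
apply: (squeeze_cvgr _ h (cvg_cst (expR (- u)))).
near=> n; rewrite expR_trunc_le andbT.
have nu : `|u| < n.+1%:R.
  near: n; exists (Num.bound `|u|) => // n /= hn.
  by rewrite (lt_le_trans (archi_boundP (normr_ge0 _)))// ler_nat leqW.
have n0 : (0 : R) < n.+1%:R by [].
set v := u / n.+1%:R.
have /andP[v1 v2] : (- 1 < v) && (v < 1).
  by rewrite -ltr_norml normrM normfV (ger0_norm (ltW n0)) ltr_pdivrMr// mul1r.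
rewrite /expR_trunc -/u -/v max_r; last by rewrite subr_ge0 ltW.
have eu : expR (- u) * expR v ^+ n.+1 = 1.
  by rewrite -expRM_natl -expRD /v mulrC divfK ?gt_eqF// addNr expR0.
have -> : (1 - v) ^+ n.+1 = expR (- u) * (expR v * (1 - v)) ^+ n.+1.
  by rewrite exprMn mulrA eu mul1r.
rewrite ler_wpM2l ?expR_ge0//.
have v21 : v ^+ 2 <= 1 by nra.
apply: (@le_trans _ _ ((1 - v ^+ 2) ^+ n.+1)).
  apply: le_trans (Bernoulli_le n.+1 v21).
  rewrite le_eqVlt; apply/orP; left; apply/eqP; rewrite /v; field.
  by rewrite gt_eqF.
rewrite lerXn2r ?nnegrE ?subr_ge0// ?mulr_ge0 ?expR_ge0 ?subr_ge0 ?(ltW v2)//.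
have -> : 1 - v ^+ 2 = (1 + v) * (1 - v) by ring.
by rewrite ler_wpM2r ?subr_ge0 ?(ltW v2)// expR_ge1Dx.
Unshelve. all: by end_near. Qed.

(** Dominated convergence for [expR_trunc], whose integrals are the Beta integrals above with
    exponent 1 and endpoint (n+1)/k. The rate [k] is kept general because the binomial series needs
    the rate 1 - z. *)
Lemma euler_limit c al k : 0 < k -> 0 < complex.Re al ->
  mu.-integrable Rp (fun s =>
    (complex.Re (c * cpowR s (al - 1)) * expR (- (k * s)))%:E) /\
  complex.Re (c * cpowR (n.+1%:R / k) al * n.+1`!%:R /
      \prod_(j < n.+2) (al + j%:R)) @[n --> \oo] -->
  \int[mu]_(s in Rp) (complex.Re (c * cpowR s (al - 1)) * expR (- (k * s))).
Proof.
move=> k0 al0; set x := complex.Re al.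
pose f s := complex.Re (c * cpowR s (al - 1)).
pose M := `|complex.Re c| + `|complex.Im c|.
have M0 : 0 <= M by rewrite addr_ge0.
have mf : measurable_fun Rp f.
  by apply: gt0_continuous_measurable => s; exact: continuous_Re_cpowR.
have mk (h : R -> R) : measurable_fun setT h -> measurable_fun Rp (fun s => (f s * h s)%:E).
  move=> mh; apply/measurable_EFinP; apply: measurable_funM => //.
  exact: measurable_funTS.
have mE := measurable_expRNM k.
have mT n : measurable_fun setT (expR_trunc k n).
  apply: measurable_funX; apply: measurable_maxr => //.
  apply: measurable_funB => //; apply: measurable_funM => //.
have := @dominated_convergence _ _ _ mu Rp (measurable_itv _)
  (fun n s => (f s * expR_trunc k n s)%:E) (fun s => (f s * expR (- (k * s)))%:E)
  (fun s => M%:E * (s `^ (x - 1) * expR (- (k * s)))%:E)%E.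
case.
- by move=> n; exact: mk.
- exact: mk.
- apply: aeW => s _; apply: cvg_EFin; first exact: nearW.
  by apply: cvgM; [exact: cvg_cst|exact: expR_trunc_cvg].
- exact/integrableZl/integrable_powR_expR.
- apply: aeW => s n _; rewrite -EFinM lee_fin normrM mulrA.
  rewrite (ger0_norm (expR_trunc_ge0 _ _ _)) ler_pM ?expR_trunc_ge0 ?expR_trunc_le//.
  have -> : x - 1 = complex.Re (al - 1) by rewrite /x; case: (al).
  exact: normr_Re_mul_cpowR.
move=> i1 _ h; split => //.
have N0 n : 0 < n.+1%:R / k by rewrite divr_gt0.
have E n : (\int[mu]_(s in Rp) (f s * expR_trunc k n s)%:E)%E =
  (complex.Re (c * cpowR (n.+1%:R / k) al * n.+1`!%:R /
      \prod_(j < n.+2) (al + j%:R)))%:E.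
  have [_] := integral_Re_cpowR_onem c n.+1 (N0 n) ltr01 al0.
  rewrite expr1n mulr1.
  under eq_bigr do rewrite mulr1.
  move=> <-.
  have -> : (`]0%R, n.+1%:R / k]%classic : set R) = Rp `&` `]0, n.+1%:R / k].
    apply/seteqP; split => s /=; rewrite !in_itv/=; first by move=> /andP[-> ->].
    by move=> [_ ->].
  rewrite integral_mkcondr; apply: eq_integral => s; rewrite inE /= in_itv/= andbT => s0.
  rewrite /patch; case: ifPn => [|]; rewrite ?inE ?notin_setE /= in_itv/= s0/=.
    move=> sN; congr (_ * _)%:E; rewrite /expR_trunc max_r; last first.
      rewrite subr_ge0 ler_pdivrMr// mul1r mulrC -ler_pdivlMr//.
    congr (_ ^+ _); rewrite powRr1; last by rewrite divr_ge0// ltW.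
    by rewrite invf_div; rewrite mulrA (mulrC s).
  move/negP; rewrite -ltNge => Ns; rewrite /expR_trunc max_l ?expr0n ?mulr0//.
  by rewrite subr_le0 ler_pdivlMr// mul1r mulrC -ler_pdivrMr// ltW.
move: h; under eq_fun do rewrite E.
rewrite -[X in _ --> X -> _]fineK; last exact: integrable_fin_num.
by move/fine_cvgP => [_].
Qed.

End gamma_limit.

(** * Products approximating Gamma *)

Section gamma_products.
Context {R : realType}.
Local Notation mu := (@lebesgue_measure R).
Local Notation Rp := (`]0%R, +oo[%classic : set R).
Implicit Types (p q s k x y : R) (c z w al : R[i]) (n : nat).

Definition poch q n : R := \prod_(j < n) (q + j%:R).
(** This is |(x + iy)_n|^2, the product of the Pochhammer symbols of two conjugate parameters. *)
Definition sqpoch x y n : R := \prod_(j < n) ((x + j%:R) ^+ 2 + y ^+ 2).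
Definition gamR q : R := \int[mu]_(s in Rp) (s `^ (q - 1) * expR (- s)).
(** The squared modulus with values in [R]; the norm of [R[i]] takes its values in [R[i]]. *)
Definition sqnorm z : R := complex.Re z ^+ 2 + complex.Im z ^+ 2.

Lemma poch_gt0 q n : 0 < q -> 0 < poch q n.
Proof. by move=> q0; apply: prodr_gt0 => j _; rewrite ltr_wpDr. Qed.

Lemma pochS q n : poch q n.+1 = poch q n * (q + n%:R).
Proof. by rewrite /poch big_ord_recr. Qed.

Lemma pochSl q n : poch q n.+1 = q * poch (q + 1) n.
Proof.
rewrite /poch big_ord_recl addr0; congr (_ * _); apply: eq_bigr => j _.
by rewrite /bump/= natrD addrA.
Qed.

Lemma sqpochS x y n :
  sqpoch x y n.+1 = sqpoch x y n * ((x + n%:R) ^+ 2 + y ^+ 2).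
Proof. by rewrite /sqpoch big_ord_recr. Qed.

Lemma sqpoch_gt0 x y n : 0 < x -> 0 < sqpoch x y n.
Proof.
move=> x0; apply: prodr_gt0 => j _.
by rewrite ltr_wpDr ?sqr_ge0// exprn_gt0// ltr_wpDr.
Qed.

Lemma poch1 n : poch 1 n = n`!%:R.
Proof.
elim: n => [|n IH]; first by rewrite /poch big_ord0.
by rewrite pochS IH factS natrM mulrC -[n.+1]add1n natrD.
Qed.

Lemma sqnormE z : (sqnorm z)%:C = `|z| ^+ 2.
Proof. exact: add_Re2_Im2. Qed.

Lemma sqnormM z w : sqnorm (z * w) = sqnorm z * sqnorm w.
Proof. by apply: complexI; rewrite rmorphM/= !sqnormE normrM exprMn. Qed.

Lemma sqnormV z : sqnorm z^-1 = (sqnorm z)^-1.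
Proof. by apply: complexI; rewrite fmorphV/= !sqnormE normfV exprVn. Qed.

Lemma sqnorm_real q : sqnorm q%:C = q ^+ 2.
Proof. by rewrite /sqnorm/= expr0n addr0. Qed.

Lemma sqnorm_nat n : sqnorm n%:R = n%:R ^+ 2.
Proof. by rewrite -(rmorph_nat (real_complex R)) sqnorm_real. Qed.

Lemma sqnorm_prod x y n :
  sqnorm (\prod_(j < n) (x +i* y + j%:R)) = sqpoch x y n.
Proof.
elim: n => [|n IH]; first by rewrite /sqpoch !big_ord0 (sqnorm_nat 1) expr1n.
rewrite big_ord_recr/= sqnormM IH sqpochS; congr (_ * _).
by rewrite -(rmorph_nat (real_complex R)) /sqnorm/= addr0.
Qed.

Lemma sqnorm_cpowR s al : sqnorm (cpowR s al) = (s `^ complex.Re al) ^+ 2.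
Proof.
rewrite /cpowR sqnormM sqnorm_real /sqnorm/= cos2Dsin2 mulr1//.
Qed.

Lemma prod_real q n : \prod_(j < n) (q%:C + j%:R) = (poch q n)%:C.
Proof.
rewrite /poch rmorph_prod; apply: eq_bigr => j _.
by rewrite rmorphD/= rmorph_nat.
Qed.

Lemma cpowR_real s q : cpowR s q%:C = (s `^ q)%:C.
Proof. by rewrite /cpowR/= mul0r cos0 sin0 mulr1. Qed.

(** Euler's product m^al m! / (al (al+1) ... (al+m)) at m = n + 1, whence n + 2 factors in the
    denominator. *)
Definition euler_seq al n : R[i] :=
  cpowR n.+1%:R al * n.+1`!%:R / \prod_(j < n.+2) (al + j%:R).

Lemma Re_mulNi z : complex.Re (- 'i%C * z) = complex.Im z.
Proof. by case: z => a b /=; ring. Qed.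

Lemma Re_Gamma_cvg al : 0 < complex.Re al ->
  complex.Re (euler_seq al n) @[n --> \oo] --> complex.Re (Gamma al).
Proof.
move=> al0; have [_] := euler_limit 1 ltr01 al0.
under eq_fun do rewrite divr1 mul1r.
congr (_ --> _); rewrite /Gamma/=; apply: eq_Rintegral => s _.
by rewrite [1 * s]mul1r; ring.
Qed.

Lemma Im_Gamma_cvg al : 0 < complex.Re al ->
  complex.Im (euler_seq al n) @[n --> \oo] --> complex.Im (Gamma al).
Proof.
move=> al0; have [_] := euler_limit (- 'i%C) ltr01 al0.
have -> : (fun n => complex.Re (- 'i%C * cpowR (n.+1%:R / 1) al * n.+1`!%:R /
    \prod_(j < n.+2) (al + j%:R))) = (fun n => complex.Im (euler_seq al n)).
  by apply/funext => n; rewrite divr1 -!mulrA Re_mulNi /euler_seq !mulrA.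
congr (_ --> _); rewrite /Gamma/=; apply: eq_Rintegral => s _.
by rewrite [1 * s]mul1r; ring.
Qed.

(** Conjugation passes through each Euler product, and the real and imaginary parts are then
    compared in the limit. *)
Lemma Gamma_conj al : 0 < complex.Re al -> Gamma al^* = (Gamma al)^*.
Proof.
move=> al0; have al0' : 0 < complex.Re al^* by case: (al) al0.
have E n : euler_seq al^* n = (euler_seq al n)^*.
  rewrite /euler_seq !rmorphM/= fmorphV/= rmorph_nat rmorph_prod/=.
  congr (_ * _ / _).
    case: (al) => a b; rewrite /cpowR/= mulNr cosN sinN.
    by apply/eqP; rewrite eq_complex/=; apply/andP; split; apply/eqP; ring.
  by apply: eq_bigr => j _; rewrite rmorphD/= rmorph_nat.
have h1 := Re_Gamma_cvg al0'; have h2 := Im_Gamma_cvg al0'.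
have g1 := Re_Gamma_cvg al0; have g2 := Im_Gamma_cvg al0.
have E1 : (fun n => complex.Re (euler_seq al^* n)) =
    (fun n => complex.Re (euler_seq al n)).
  by apply/funext => n; rewrite E; case: (euler_seq al n).
have E2 : (fun n => complex.Im (euler_seq al^* n)) =
    (fun n => - complex.Im (euler_seq al n)).
  by apply/funext => n; rewrite E; case: (euler_seq al n).
rewrite E1 in h1; rewrite E2 in h2.
have e1 : complex.Re (Gamma al^*) = complex.Re (Gamma al).
  by rewrite -(cvg_lim _ h1)// (cvg_lim _ g1).
have e2 : complex.Im (Gamma al^*) = - complex.Im (Gamma al).
  by rewrite -(cvg_lim _ h2)// (cvg_lim _ (cvgN g2)).
by move: e1 e2; case: (Gamma al) => a b; case: (Gamma al^*) => a' b' /= -> ->.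
Qed.

Lemma Gamma_mul_conj al : 0 < complex.Re al ->
  Gamma al * Gamma al^* = (sqnorm (Gamma al))%:C.
Proof.
by move=> al0; rewrite Gamma_conj// sqnormE sqr_normc.
Qed.

Lemma Gamma_real q : Gamma q%:C = (gamR q)%:C.
Proof.
have E s : cpowR s (q%:C - 1) * (expR (- s))%:C =
    (s `^ (q - 1) * expR (- s))%:C.
  by rewrite -(rmorph1 (real_complex R)) -rmorphB cpowR_real -rmorphM.
rewrite /Gamma; congr (_ +i* _).
  by apply: eq_Rintegral => s _; rewrite E.
rewrite (@eq_Rintegral _ _ _ _ _ (cst 0)); last by move=> s _; rewrite E.
by rewrite /Rintegral integral0.
Qed.

Lemma gamR_cvg q : 0 < q ->
  n.+1%:R `^ q * n.+1`!%:R / poch q n.+2 @[n --> \oo] --> gamR q.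
Proof.
move=> q0; have := @Re_Gamma_cvg q%:C q0.
rewrite Gamma_real/=.
suff -> : (fun n => complex.Re (euler_seq q%:C n)) =
    (fun n => n.+1%:R `^ q * n.+1`!%:R / poch q n.+2) by [].
apply/funext => n; rewrite /euler_seq cpowR_real prod_real -(rmorph_nat (real_complex R)).
by rewrite -fmorphV -!rmorphM.
Qed.

Lemma sqGamma_cvg x y : 0 < x ->
  (n.+1%:R `^ x * n.+1`!%:R) ^+ 2 / sqpoch x y n.+2 @[n --> \oo] -->
  sqnorm (Gamma (x +i* y)).
Proof.
move=> x0; have h1 := @Re_Gamma_cvg (x +i* y) x0.
have h2 := @Im_Gamma_cvg (x +i* y) x0.
have -> : (fun n => (n.+1%:R `^ x * n.+1`!%:R) ^+ 2 / sqpoch x y n.+2) =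
    (fun n => sqnorm (euler_seq (x +i* y) n)).
  apply/funext => n; rewrite /euler_seq 2!sqnormM sqnormV.
  by rewrite sqnorm_prod sqnorm_nat sqnorm_cpowR/= exprMn.
by rewrite /sqnorm; apply: cvgD; rewrite !expr2; exact: cvgM.
Qed.

(** On ]0, 1] the exponential is at least e^(-1), so the integral is at least e^(-1)/q. *)
Lemma gamR_gt0 q : 0 < q -> 0 < gamR q.
Proof.
move=> q0.
pose f s := s `^ (q - 1) * expR (- s).
have i1 : mu.-integrable Rp (EFin \o f).
  apply: eq_integrable (integrable_powR_expR q0 ltr01) => // s _.
  by rewrite [1 * s]mul1r.
have f0 s : 0 <= f s by rewrite mulr_ge0 ?powR_ge0 ?expR_ge0.
have mf := measurable_int mu i1.
have [i2 e2] := @integral_Re_cpowR R (q^-1)%:C q%:C 1 ltr01 q0.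
have E s : complex.Re ((q^-1)%:C * q%:C * cpowR s (q%:C - 1)) = s `^ (q - 1).
  rewrite -rmorphM mulVf ?gt_eqF// -(rmorph1 (real_complex R)) -rmorphB.
  by rewrite cpowR_real mul1r.
have sub : `]0%R, 1%R] `<=` Rp.
  by move=> s /=; rewrite !in_itv/= => /andP[->].
suff : (0 < \int[mu]_(s in Rp) (f s)%:E)%E.
  by rewrite -(fineK (integrable_fin_num _ i1))// lte_fin.
apply: (@lt_le_trans _ _ (\int[mu]_(s in `]0%R, 1%R]) (f s)%:E)%E); last first.
  by apply: ge0_subset_integral => // s _; rewrite lee_fin.
apply: (@lt_le_trans _ _ ((expR (-1))%:E * \int[mu]_(s in `]0%R, 1%R]) (s `^ (q - 1))%:E)%E).
  rewrite mule_gt0 ?lte_fin ?expR_gt0//.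
  under eq_integral do rewrite -E.
  by rewrite e2 cpowR_real -rmorphM/= powR1 mulr1 lte_fin invr_gt0.
have mp : measurable_fun (`]0%R, 1%R]%classic : set R) (fun s => (s `^ (q - 1))%:E).
  apply/measurable_EFinP; apply: measurable_funTS; exact: measurable_powR.
rewrite -ge0_integralZl ?lee_fin ?expR_ge0//; last first.
  by move=> s _; rewrite lee_fin powR_ge0.
apply: ge0_le_integral => //.
- by move=> s _; rewrite mule_ge0 ?lee_fin ?expR_ge0 ?powR_ge0.
- by apply: emeasurable_funM.
- exact: measurable_funS mf.
move=> s /=; rewrite in_itv/= => /andP[s0 s1].
by rewrite lee_fin mulrC ler_wpM2l ?powR_ge0// ler_expR lerN2.
Qed.

(** Each new factor contributes 1 + y^2/(b+1)^2, which is at most exp(y^2 (1/b - 1/(b+1))) because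
    1/(b+1)^2 <= 1/(b(b+1)). The exponents telescope, so the ratio to (x)_n^2 stays bounded in n. *)
Lemma sqpoch_le x y n : 0 < x -> sqpoch x y n.+1 <=
  poch x n.+1 ^+ 2 *
  ((1 + y ^+ 2 / x ^+ 2) * expR (y ^+ 2 * (x^-1 - (x + n%:R)^-1))).
Proof.
move=> x0; elim: n => [|n IH].
  rewrite /sqpoch /poch !big_ord_recl !big_ord0 !addr0 !mulr1 subrr mulr0 expR0.
  rewrite mulr1 le_eqVlt; apply/orP; left; apply/eqP.
  by field; rewrite gt_eqF.
set b := x + n%:R; have b0 : 0 < b by rewrite ltr_wpDr.
have b1E : x + n.+1%:R = b + 1 by rewrite -[n.+1]addn1 natrD addrA.
have b10 : 0 < b + 1 by rewrite addr_gt0.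
have hb : (b + 1) ^+ 2 + y ^+ 2 <=
    (b + 1) ^+ 2 * expR (y ^+ 2 * (b^-1 - (b + 1)^-1)).
  have -> : (b + 1) ^+ 2 + y ^+ 2 = (b + 1) ^+ 2 * (1 + y ^+ 2 / (b + 1) ^+ 2).
    by field; rewrite gt_eqF.
  rewrite ler_wpM2l ?sqr_ge0// (le_trans (expR_ge1Dx _))// ler_expR.
  rewrite ler_wpM2l ?sqr_ge0//.
  have -> : b^-1 - (b + 1)^-1 = (b * (b + 1))^-1 by field; rewrite !gt_eqF.
  by rewrite lef_pV2 ?posrE ?exprn_gt0 ?mulr_gt0// expr2 ler_wpM2r ?lerDl// ltW.
rewrite sqpochS pochS b1E.
apply: (le_trans (ler_pM _ _ IH hb)).
- by rewrite ltW// sqpoch_gt0.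
- by rewrite addr_ge0// sqr_ge0.
rewrite -/b le_eqVlt; apply/orP; left; apply/eqP.
have -> : y ^+ 2 * (x^-1 - (b + 1)^-1) =
  y ^+ 2 * (x^-1 - b^-1) + y ^+ 2 * (b^-1 - (b + 1)^-1) by ring.
by rewrite expRD; ring.
Qed.

(** The modulus of Gamma is compared with Gamma at the real part: by the uniform bound [K] on the
    ratio of the products, |Gamma(x + iy)|^2 >= Gamma(x)^2 / K. *)
Lemma sqGamma_gt0 x y : 0 < x -> 0 < sqnorm (Gamma (x +i* y)).
Proof.
move=> x0; pose K := (1 + y ^+ 2 / x ^+ 2) * expR (y ^+ 2 * x^-1).
have K0 : 0 < K.
  by rewrite mulr_gt0 ?expR_gt0// ltr_pwDl// divr_ge0// sqr_ge0.
have g0 := gamR_gt0 x0.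
apply: (@lt_le_trans _ _ (gamR x ^+ 2 / K)); first by rewrite divr_gt0// exprn_gt0.
have h1 : (n.+1%:R `^ x * n.+1`!%:R / poch x n.+2) ^+ 2 / K @[n --> \oo] -->
    gamR x ^+ 2 / K.
  apply: cvgM; last exact: cvg_cst.
  by rewrite !expr2; apply: cvgM; exact: gamR_cvg.
have h2 := sqGamma_cvg (y := y) x0.
rewrite -(cvg_lim _ h1)// -(cvg_lim _ h2)//; apply: ler_lim.
- by apply/cvg_ex; eexists; exact: h1.
- by apply/cvg_ex; eexists; exact: h2.
apply: nearW => n.
have p0 := poch_gt0 n.+2 x0; have s0 := sqpoch_gt0 y n.+2 x0.
rewrite expr_div_n -mulrA ler_wpM2l ?sqr_ge0// -invfM.
have pK0 : 0 < poch x n.+2 ^+ 2 * K by apply: mulr_gt0 => //; exact: exprn_gt0.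
rewrite lef_pV2 ?posrE//.
apply: (le_trans (sqpoch_le y n.+1 x0)).
rewrite ler_wpM2l ?sqr_ge0// ler_wpM2l ?addr_ge0// ?divr_ge0 ?sqr_ge0//.
by rewrite ler_expR ler_wpM2l ?sqr_ge0// gerBl invr_ge0 addr_ge0// ltW.
Qed.

(** Shifted by 2, the ratio is a quotient of Euler products for p, q and x + iy: the factorials
    cancel, and so do the powers of n + 1 because p + q = 2x. *)
Lemma sqpoch_ratio_cvg p q x y : 0 < p -> 0 < q -> 0 < x -> p + q = x + x ->
  sqpoch x y n / (poch p n * poch q n) @[n --> \oo] -->
  gamR p * gamR q / sqnorm (Gamma (x +i* y)).
Proof.
move=> p0 q0 x0 pq; rewrite -(cvg_shiftn 2).
have -> : (fun n => sqpoch x y (n + 2) / (poch p (n + 2) * poch q (n + 2))) =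
  (fun n => (n.+1%:R `^ p * n.+1`!%:R / poch p n.+2) *
            (n.+1%:R `^ q * n.+1`!%:R / poch q n.+2) /
            ((n.+1%:R `^ x * n.+1`!%:R) ^+ 2 / sqpoch x y n.+2)).
  apply/funext => n; rewrite addn2.
  have pp0 := poch_gt0 n.+2 p0; have qq0 := poch_gt0 n.+2 q0.
  have s0 := sqpoch_gt0 y n.+2 x0.
  have f0 : n.+1`!%:R != 0 :> R by rewrite pnatr_eq0 -lt0n fact_gt0.
  have xx0 : n.+1%:R `^ x != 0 :> R by rewrite gt_eqF// powR_gt0.
  have : n.+1%:R `^ p * n.+1%:R `^ q = n.+1%:R `^ x * n.+1%:R `^ x :> R.
    by rewrite -!powRD ?pq// pnatr_eq0 implybT.
  move=> E; rewrite -[RHS](_ : (n.+1%:R `^ p * n.+1%:R `^ q) * n.+1`!%:R ^+ 2 /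
      (poch p n.+2 * poch q n.+2) * (sqpoch x y n.+2 /
      (n.+1%:R `^ x * n.+1`!%:R) ^+ 2) = _).
    by rewrite E; field; rewrite f0 xx0 !gt_eqF.
  by field; rewrite f0 xx0 !gt_eqF.
apply: cvgM; first by apply: cvgM; exact: gamR_cvg.
apply: cvgV; last exact: sqGamma_cvg.
by rewrite gt_eqF// sqGamma_gt0.
Qed.

(** Instead of a change of variables, the factor k^(-q) is read off Euler's product, where (m/k)^q =
    k^(-q) m^q. *)
Lemma integral_powR_expR q k : 0 < q -> 0 < k ->
  (\int[mu]_(s in Rp) (s `^ (q - 1) * expR (- (k * s)))%:E =
   (k `^ (- q) * gamR q)%:E)%E.
Proof.
move=> q0 k0.
have i1 := integrable_powR_expR q0 k0.
have [_] := @euler_limit R 1 q%:C k k0 q0.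
have -> : (fun n => complex.Re (1 * cpowR (n.+1%:R / k) q%:C * n.+1`!%:R /
    \prod_(j < n.+2) (q%:C + j%:R))) =
   (fun n => k `^ (- q) * (n.+1%:R `^ q * n.+1`!%:R / poch q n.+2)).
  apply/funext => n; rewrite mul1r cpowR_real prod_real.
  rewrite -(rmorph_nat (real_complex R)) -fmorphV -!rmorphM/=.
  rewrite powRM ?invr_ge0 ?ler0n ?(ltW k0)// -powR_inv1 ?(ltW k0)// -powRrM mulN1r.
  by ring.
have -> : (\int[mu]_(s in Rp) (complex.Re (1 * cpowR s (q%:C - 1)) *
     expR (- (k * s))))%R = (\int[mu]_(s in Rp) (s `^ (q - 1) * expR (- (k * s))))%R.
  apply: eq_Rintegral => s _; congr (_ * _).
  by rewrite mul1r -(rmorph1 (real_complex R)) -rmorphB cpowR_real.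
move=> h1; rewrite -[LHS]fineK; last exact: integrable_fin_num.
congr EFin; rewrite -[LHS](cvg_lim _ h1)//; apply: cvg_lim => //.
by apply: cvgM; [exact: cvg_cst|exact: gamR_cvg].
Qed.

(** With m = n + 1, the Euler products at q + 1 and q differ by the factor q m/(q + 1 + m), which
    tends to q. *)
Lemma gamRS q : 0 < q -> gamR (q + 1) = q * gamR q.
Proof.
move=> q0; have q10 : 0 < q + 1 by rewrite addr_gt0.
rewrite -(cvg_lim _ (gamR_cvg q10))//; apply: cvg_lim => //.
have -> : (fun n => n.+1%:R `^ (q + 1) * n.+1`!%:R / poch (q + 1) n.+2) =
  (fun n => q * (1 - (q + 1) / (q + 1 + n.+1%:R)) *
     (n.+1%:R `^ q * n.+1`!%:R / poch q n.+2)).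
  apply/funext => n.
  have e1 := pochSl q n.+2; have e2 := pochS q n.+2.
  have p0 := poch_gt0 n.+2 q0; have p1 := poch_gt0 n.+2 q10.
  have qn0 : 0 < q + 1 + n.+1%:R by rewrite addr_gt0.
  have -> : poch (q + 1) n.+2 = poch q n.+2 * (q + 1 + n.+1%:R) / q.
    have -> : q + 1 + n.+1%:R = q + n.+2%:R by rewrite -[n.+2]add1n natrD addrA.
    by rewrite -e2 e1 mulrC mulKf// gt_eqF.
  rewrite powRD ?powRr1 ?pnatr_eq0 ?implybT//.
  by move: qn0; move: (n.+1%:R : R) => m qn0; field; rewrite !gt_eqF.
rewrite -[X in _ --> X](_ : q * 1 * gamR q = _); last by rewrite mulr1.
apply: cvgM; last exact: gamR_cvg.
apply: cvgM; first exact: cvg_cst.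
rewrite -[X in _ --> X]subr0; apply: cvgB; first exact: cvg_cst.
rewrite -[X in _ --> X](mulr0 (q + 1)); apply: cvgM; first exact: cvg_cst.
apply: (squeeze_cvgr _ (cvg_cst 0) cvg_harmonic).
apply: nearW => n; rewrite invr_ge0 addr_ge0 ?(ltW q10)//=.
by rewrite lef_pV2 ?posrE ?addr_gt0// lerDr ltW.
Qed.

Lemma gamRDn q n : 0 < q -> gamR (q + n%:R) = gamR q * poch q n.
Proof.
move=> q0; elim: n => [|n IH]; first by rewrite addr0 /poch big_ord0 mulr1.
rewrite -[n.+1]addn1 natrD addrA gamRS ?IH ?ltr_wpDr// addn1 pochS.
by ring.
Qed.

End gamma_products.

(** * Abelian theorems for power series *)

Section power_series.
Context {R : realType}.
Local Notation mu := (@lebesgue_measure R).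
Local Notation Rp := (`]0%R, +oo[%classic : set R).
Implicit Types (c d u : R^nat) (L S p q x y z : R) (n : nat).

Definition powser c z : R := limn (series (fun n => c n * z ^+ n)).

Lemma nneseries_cvg u S : (forall n, 0 <= u n) ->
  (\sum_(n <oo) (u n)%:E = S%:E)%E -> series u @ \oo --> S.
Proof.
move=> u0 uS.
have : (\sum_(0 <= i < n) (u i)%:E @[n --> \oo] --> S%:E)%E.
  by rewrite -uS; apply: is_cvg_nneseries => n _ _; rewrite lee_fin.
move/fine_cvgP => [_]; apply: cvg_trans.
rewrite (_ : fine \o _ = series u)//.
by apply/funext => n /=; rewrite sumEFin.
Qed.

Lemma cvg_nneseries u S : series u @ \oo --> S ->
  (\sum_(n <oo) (u n)%:E = S%:E)%E.
Proof.
move=> uS; apply/cvg_lim => //.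
have -> : (fun n => \sum_(0 <= i < n) (u i)%:E)%E = EFin \o series u.
  by apply/funext => n /=; rewrite sumEFin.
by apply: cvg_EFin => //; exact: nearW.
Qed.

Lemma nondecreasing_series_ge0 u : (forall n, 0 <= u n) ->
  nondecreasing_seq (series u).
Proof. by move=> u0; apply: nondecreasing_series => n _ _. Qed.

Lemma series_expR z : series (fun n => z ^+ n / n`!%:R) @ \oo --> expR z.
Proof.
have := is_cvg_series_exp_coeff z.
rewrite /expR; congr (cvg_to _ _).
Qed.

(** Expand e^(zs) in the integral of s^(q-1) e^(-s) e^(zs), which is (1 - z)^(-q) Gamma(q). The term
    of degree n integrates to z^n/n! Gamma(q + n) = Gamma(q) (q)_n z^n/n!, and Gamma(q) > 0 is
    divided out. *)
Lemma binomial_series q z : 0 < q -> 0 <= z < 1 ->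
  series (fun n => poch q n / n`!%:R * z ^+ n) @ \oo --> (1 - z) `^ (- q).
Proof.
move=> q0 /andP[z0 z1]; have z10 : 0 < 1 - z by rewrite subr_gt0.
have g0 := gamR_gt0 q0.
pose f n s : R := z ^+ n / n`!%:R * (s `^ (q + n%:R - 1) * expR (- (1 * s))).
have f0 n s : 0 <= f n s.
  by rewrite mulr_ge0 ?divr_ge0 ?exprn_ge0// mulr_ge0 ?powR_ge0 ?expR_ge0.
have qn0 n : 0 < q + n%:R by rewrite ltr_wpDr.
have mg n : measurable_fun Rp (fun s => (s `^ (q + n%:R - 1) * expR (- (1 * s)))%:E).
  exact: (measurable_int mu (integrable_powR_expR (qn0 n) ltr01)).
have If n : (\int[mu]_(s in Rp) (f n s)%:E =
    (gamR q * (poch q n / n`!%:R * z ^+ n))%:E)%E.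
  under eq_integral do rewrite EFinM.
  rewrite ge0_integralZl ?lee_fin ?divr_ge0 ?exprn_ge0//; last first.
    by move=> s _; rewrite lee_fin mulr_ge0 ?powR_ge0 ?expR_ge0.
    exact: mg.
  rewrite integral_powR_expR// -EFinM powR1 mul1r gamRDn//.
  by congr EFin; ring.
have Sf s : s \in Rp -> (\sum_(n <oo) (f n s)%:E =
    (s `^ (q - 1) * expR (- ((1 - z) * s)))%:E)%E.
  rewrite inE /= in_itv/= andbT => s0; apply: cvg_nneseries.
  have -> : (fun n => f n s) = (s `^ (q - 1) * expR (- s)) *:
      (fun n => (z * s) ^+ n / n`!%:R).
    apply/funext => n; rewrite /f /GRing.scale/= mul1r.
    have -> : q + n%:R - 1 = q - 1 + n%:R by ring.
    rewrite powRD ?(gt_eqF s0) ?implybT// powR_mulrn ?(ltW s0)// exprMn.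
    by rewrite /GRing.scale/=; ring.
  rewrite seriesZ.
  have -> : s `^ (q - 1) * expR (- ((1 - z) * s)) =
     s `^ (q - 1) * expR (- s) *: (expR (z * s) : R^o).
    by rewrite /GRing.scale/= -mulrA -expRD; congr (_ * expR _); ring.
  by apply: cvgZr; exact: series_expR.
have : (\int[mu]_(s in Rp) (\sum_(n <oo) (f n s)%:E) =
    \sum_(n <oo) (gamR q * (poch q n / n`!%:R * z ^+ n))%:E)%E.
  rewrite integral_nneseries//.
  - by under eq_eseriesr do rewrite If.
  - move=> n; apply/measurable_EFinP; apply: measurable_funM => //.
    by apply/measurable_EFinP; exact: mg.
  - by move=> n s _; rewrite lee_fin.
under eq_integral => s sR do rewrite (Sf s sR).
rewrite integral_powR_expR// => /esym/nneseries_cvg h.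
have {}h : series (fun n => gamR q * (poch q n / n`!%:R * z ^+ n)) @ \oo -->
    (1 - z) `^ (- q) * gamR q.
  apply: h => n; rewrite mulr_ge0 ?(ltW g0)// mulr_ge0 ?exprn_ge0//.
  by rewrite divr_ge0// ltW// poch_gt0.
have -> : (1 - z) `^ (- q) = (gamR q)^-1 * ((1 - z) `^ (- q) * gamR q).
  by rewrite mulrCA mulVf ?mulr1// gt_eqF.
have -> : series (fun n => poch q n / n`!%:R * z ^+ n) = (fun n => (gamR q)^-1 *
    series (fun n => gamR q * (poch q n / n`!%:R * z ^+ n)) n).
  by apply/funext => n; rewrite /series/= -mulr_sumr mulKf// gt_eqF.
by apply: cvgM => //; exact: cvg_cst.
Qed.

Lemma log_series z : 0 < z < 1 ->
  series (fun n => n%:R^-1 * z ^+ n) @ \oo --> - ln (1 - z).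
Proof.
move=> /andP[z0 z1]; have z10 : 0 < 1 - z by rewrite subr_gt0.
have I1 n : (\int[mu]_(s in `]0%R, z]) (s ^+ n)%:E = (n.+1%:R^-1 * z ^+ n.+1)%:E)%E.
  apply: (@ge0_integral_itv_oc0 _ (fun s => s ^+ n) (fun s => n.+1%:R^-1 * s ^+ n.+1)) => //.
  - by move=> s /andP[s0 _]; rewrite exprn_ge0// ltW.
  - move=> s _.
    have dX : is_derive s 1 (@GRing.exp R ^~ n.+1) (n.+1%:R *: s ^+ n *: 1).
      by split; [exact: exprn_derivable|rewrite exp_derive].
    apply: is_derive_eq.
    by rewrite /GRing.scale/= mulr1 mulrA mulVf ?mul1r// pnatr_eq0.
  - by move=> s _; exact: exprn_continuous.
  - apply: cvg_at_right_filter; rewrite -[X in _ --> X](mulr0 n.+1%:R^-1).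
    apply: cvgM; first exact: cvg_cst.
    by rewrite -[X in _ --> X](expr0n _ n.+1); exact: exprn_continuous.
have I2 : (\int[mu]_(s in `]0%R, z]) ((1 - s)^-1)%:E = (- ln (1 - z))%:E)%E.
  have pos s : s <= z -> 0 < 1 - s by move=> sz; rewrite subr_gt0 (le_lt_trans sz).
  have d1 (s : R) : is_derive s (1 : R) (fun s : R => 1 - s) (-1).
    by apply: is_derive_eq; ring.
  have dl (s : R) : s <= z -> is_derive s 1 (fun s => - ln (1 - s)) ((1 - s)^-1).
    move=> sz; have d2 := is_derive1_ln (pos s sz).
    have d3 := @is_derive1_comp _ (@ln R) (fun s => 1 - s) _ _ _ d2 (d1 s).
    have d4 := is_deriveN d3; apply: is_derive_eq d4 _.
    by rewrite mulrN1 opprK.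
  apply: (@ge0_integral_itv_oc0 _ (fun s => (1 - s)^-1) (fun s => - ln (1 - s))) => //.
  - by move=> s /andP[_ sz]; rewrite invr_ge0 ltW// pos.
  - by move=> s /andP[_ sz]; exact: dl.
  - move=> s /andP[_ sz]; apply: cvgV; first by rewrite gt_eqF// pos.
    by apply: cvgB; [exact: cvg_cst|exact: cvg_id].
  - apply: cvg_at_right_filter.
    rewrite -[X in _ --> X](_ : - ln (1 - 0 : R) = 0); last by rewrite subr0 ln1 oppr0.
    suff : {for (0 : R), continuous (fun s : R => - ln (1 - s))} by [].
    apply: differentiable_continuous; apply/derivable1_diffP.
    by have [] := dl 0 (ltW z0).
have : (\int[mu]_(s in `]0%R, z]) (\sum_(n <oo) (s ^+ n)%:E) =
    \sum_(n <oo) (n.+1%:R^-1 * z ^+ n.+1)%:E)%E.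
  rewrite integral_nneseries//.
  - by under eq_eseriesr do rewrite I1.
  - by move=> n; apply/measurable_EFinP; exact: measurable_funX.
  - move=> n s /=; rewrite in_itv/= => /andP[s0 _].
    by rewrite lee_fin exprn_ge0// ltW.
under eq_integral => s.
  rewrite inE /= in_itv/= => /andP[s0 sz].
  have -> : (\sum_(n <oo) (s ^+ n)%:E = ((1 - s)^-1)%:E)%E.
    apply: cvg_nneseries; have := @cvg_geometric_series R 1 s.
    rewrite mul1r ger0_norm ?ltW// => /(_ (le_lt_trans sz z1)).
    by rewrite (_ : geometric 1 s = (fun n => s ^+ n))//;
      apply/funext => n; rewrite /geometric/= mul1r.
  over.
rewrite I2 => /esym/nneseries_cvg h.
have {}h : series (fun n => n.+1%:R^-1 * z ^+ n.+1) @ \oo --> - ln (1 - z).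
  by apply: h => n; rewrite mulr_ge0 ?invr_ge0// exprn_ge0// ltW.
(* The integrated geometric series starts in degree 1. The convention [0^-1 = 0] makes the term of
   degree 0 vanish, so the two series agree up to a shift of index. *)
pose U : R^nat := series (fun n => n%:R^-1 * z ^+ n).
suff : U @ \oo --> - ln (1 - z) by [].
rewrite -(cvg_shiftn 1).
suff -> : (fun n => U (n + 1)%N) = series (fun n => n.+1%:R^-1 * z ^+ n.+1) by [].
by apply/funext => n; rewrite addn1 /U /series/= big_nat_recl//= invr0 mul0r add0r.
Qed.

Lemma powser_le c z m : (forall n, 0 <= c n) -> 0 <= z ->
  cvgn (series (fun n => c n * z ^+ n)) ->
  \sum_(0 <= i < m) c i * z ^+ i <= powser c z.
Proof.
move=> c0 z0 cz; apply: (nondecreasing_cvgn_le _ cz).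
by apply: nondecreasing_series_ge0 => n; rewrite mulr_ge0// exprn_ge0.
Qed.

Lemma is_cvg_series_bound u M : (forall n, 0 <= u n) ->
  (\forall m \near \oo, series u m <= M) -> cvgn (series u).
Proof.
move=> u0 [N _ uM]; apply: nondecreasing_is_cvgn.
  exact: nondecreasing_series_ge0.
exists M => _ [m _ <-]; apply: le_trans (uM (maxn m N) (leq_maxr _ _)).
exact/nondecreasing_series_ge0/leq_maxl.
Qed.

(** The terms below [N] are bounded by using z^i <= 1, so their contribution does not depend on z;
    this is what a divergent comparison series absorbs as z -> 1. *)
Lemma powser_compare c d L e N z m : (forall n, 0 <= d n) -> 0 <= z <= 1 ->
  0 <= e -> (forall n, (N <= n)%N -> `|c n - L * d n| <= e * d n) -> (N <= m)%N ->
  `|\sum_(0 <= i < m) c i * z ^+ i - L * \sum_(0 <= i < m) d i * z ^+ i| <=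
  \sum_(0 <= i < N) `|c i - L * d i| + e * \sum_(0 <= i < m) d i * z ^+ i.
Proof.
move=> d0 /andP[z0 z1] e0 H Nm.
have zi i : 0 <= z ^+ i by rewrite exprn_ge0.
rewrite mulr_sumr -sumrB.
under eq_bigr do rewrite mulrA -mulrBl.
apply: le_trans (ler_norm_sum _ _ _) _.
rewrite (big_cat_nat (leq0n N) Nm)//= lerD//.
  apply: ler_sum => i _; rewrite normrM (ger0_norm (zi i)).
  by rewrite ler_piMr// exprn_ile1.
apply: (@le_trans _ _ (e * \sum_(N <= i < m) d i * z ^+ i)).
  rewrite mulr_sumr big_nat_cond [leRHS]big_nat_cond; apply: ler_sum => i.
  move=> /andP[/andP[Ni _] _]; rewrite normrM (ger0_norm (zi i)) mulrA.
  by rewrite ler_wpM2r// H.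
rewrite ler_wpM2l// [leRHS](big_cat_nat (leq0n N) Nm)//= lerDr.
by apply: sumr_ge0 => i _; rewrite mulr_ge0.
Qed.

(** The positivity of [d] is asked only eventually, to admit the logarithmic series, whose
    coefficient of degree 0 is 0. *)
Lemma powser_abelian c d L (D : R -> R) :
  (forall n, 0 <= c n) -> (forall n, 0 <= d n) ->
  (\forall n \near \oo, 0 < d n) ->
  c n / d n @[n --> \oo] --> L ->
  (forall z, 0 < z < 1 -> series (fun n => d n * z ^+ n) @ \oo --> D z) ->
  D z @[z --> 1^'-] --> +oo ->
  (forall z, 0 < z < 1 -> cvgn (series (fun n => c n * z ^+ n))) /\
  powser c z / D z @[z --> 1^'-] --> L.
Proof.
move=> c0 d0 dpos cdL dD Doo.
have dle z m : 0 < z < 1 -> \sum_(0 <= i < m) d i * z ^+ i <= D z.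
  move=> z01; have <- : powser d z = D z by apply/cvg_lim => //; exact: dD.
  apply: powser_le => //; first by case/andP : z01 => /ltW.
  by apply/cvg_ex; exists (D z); exact: dD.
have key e : 0 < e -> exists2 K, 0 <= K & forall z, 0 < z < 1 ->
    \forall m \near \oo, `|series (fun n => c n * z ^+ n) m -
       L * series (fun n => d n * z ^+ n) m| <= K + e * D z.
  move=> e0; have [N _ HN] : \forall n \near \oo, `|c n - L * d n| <= e * d n.
    move/cvgrPdist_le : cdL => /(_ _ e0) cdL; near=> n.
    have dn0 : 0 < d n by near: n.
    have -> : c n - L * d n = - (L - c n / d n) * d n.
      by field; rewrite gt_eqF.
    rewrite normrM normrN (ger0_norm (d0 n)) ler_wpM2r//.
    by near: n.
  exists (\sum_(0 <= i < N) `|c i - L * d i|); first exact: sumr_ge0.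
  move=> z z01; exists N => // m /= Nm; rewrite /series/=.
  have z01' : 0 <= z <= 1 by case/andP : z01 => /ltW -> /ltW ->.
  apply: (le_trans (powser_compare d0 z01' (ltW e0) HN Nm)).
  rewrite lerD2l ler_wpM2l ?(ltW e0)//.
  exact: dle.
have cvgc z : 0 < z < 1 -> cvgn (series (fun n => c n * z ^+ n)).
  move=> z01; have [K K0 /(_ z z01) HK] := key 1 ltr01.
  have /andP[z0 z1] := z01.
  apply: (@is_cvg_series_bound _ (`|L| * D z + (K + 1 * D z))).
    by move=> n; rewrite mulr_ge0// exprn_ge0// ltW.
  apply: filterS HK => m; rewrite ler_norml => /andP[_]; rewrite lerBlDl => h.
  apply: (le_trans h); rewrite lerD2r (le_trans (ler_norm _))// normrM.
  rewrite ler_wpM2l// ger0_norm; last first.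
    by apply: sumr_ge0 => i _; rewrite mulr_ge0// exprn_ge0// ltW.
  exact: dle.
split => //.
apply/cvgrPdist_le => e e0.
have e20 : 0 < e / 2 by rewrite divr_gt0.
have [K K0 HK] := key _ e20.
near=> z.
have z01 : 0 < z < 1.
  apply/andP; split; last by [].
  by near: z; apply: nbhs_left_gt.
(* The 1 ensures D z > 0, and the second entry makes the constant K from the head at most (e/2) D
   z. *)
have Dz : Num.max 1 (K / (e / 2)) <= D z.
  by near: z; move/cvgryPge : Doo; apply.
have Dz0 : 0 < D z by rewrite (lt_le_trans _ Dz)// lt_max ltr01.
have h : `|powser c z - L * D z| <= K + e / 2 * D z.
  have hc : `|series (fun n => c n * z ^+ n) m -
       L * series (fun n => d n * z ^+ n) m| @[m --> \oo] -->
      `|powser c z - L * D z|.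
    apply: cvg_norm; apply: cvgB; first exact: cvgc.
    by apply: cvgM; [exact: cvg_cst|exact: dD].
  rewrite -(cvg_lim _ hc)//; apply: limr_le; last exact: HK.
  by apply/cvg_ex; eexists; exact: hc.
have -> : L - powser c z / D z = - ((powser c z - L * D z) / D z).
  by field; rewrite gt_eqF.
rewrite normrN normrM normfV (gtr0_norm Dz0) ler_pdivrMr//.
apply: (le_trans h).
have : K <= e / 2 * D z.
  rewrite mulrC -ler_pdivrMr//; apply: le_trans Dz.
  by rewrite le_max lexx orbT.
by move=> hK; lra.
Unshelve. all: by end_near. Qed.

(** Nonnegativity replaces summation by parts: S bounds the power series from above, and a partial
    sum close to S, being a polynomial in z, bounds it from below near 1. *)
Lemma powser_abel c S : (forall n, 0 <= c n) -> series c @ \oo --> S ->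
  powser c z @[z --> 1^'-] --> S.
Proof.
move=> c0 cS.
have cvgc z : 0 < z < 1 -> cvgn (series (fun n => c n * z ^+ n)).
  move=> /andP[z0 z1]; apply: (@series_le_cvg _ _ c) => //.
  - by move=> n; rewrite mulr_ge0// exprn_ge0// ltW.
  - by move=> n; rewrite ler_piMr// exprn_ile1// ltW.
  - by apply/cvg_ex; exists S.
apply/cvgrPdist_le => e e0.
have e20 : 0 < e / 2 by rewrite divr_gt0.
have [N _ HN] : \forall n \near \oo, `|S - series c n| <= e / 2.
  by move/cvgrPdist_le : cS; apply.
have hN : \sum_(0 <= i < N) c i * z ^+ i @[z --> 1^'-] --> series c N.
  rewrite /series/=; elim: (N) => [|k IH].
    by rewrite big_nil; under eq_fun do rewrite big_nil; exact: cvg_cst.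
  rewrite big_nat_recr//=; under eq_fun do rewrite big_nat_recr//=.
  apply: cvgD => //; rewrite -[X in _ --> X](_ : c k * 1 ^+ k = _); last first.
    by rewrite expr1n mulr1.
  apply: cvgM; first exact: cvg_cst.
  by apply: cvg_at_left_filter; exact: exprn_continuous.
near=> z.
have z01 : 0 < z < 1.
  apply/andP; split; last by [].
  by near: z; apply: nbhs_left_gt.
have /andP[z0 z1] := z01.
have h1 : `|series c N - \sum_(0 <= i < N) c i * z ^+ i| <= e / 2.
  by near: z; move/cvgrPdist_le : hN; apply.
have h2 : powser c z <= S.
  apply: limr_le; first exact: cvgc.
  apply: nearW => m; apply: (@le_trans _ _ (series c m)).
    by apply: ler_sum => i _; rewrite ler_piMr// exprn_ile1// ltW.
  rewrite -(cvg_lim _ cS)//; apply: nondecreasing_cvgn_le.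
    exact: nondecreasing_series_ge0.
  by apply/cvg_ex; exists S.
have h3 : \sum_(0 <= i < N) c i * z ^+ i <= powser c z.
  by apply: powser_le => //; [exact: ltW|exact: cvgc].
have h4 := HN N (leqnn N).
move: h1 h4; rewrite !ler_norml => /andP[_ h1] /andP[_ h4].
by apply/andP; split; lra.
Unshelve. all: by end_near. Qed.

Lemma cvg_bin_pole q : 0 < q -> (1 - z) `^ (- q) @[z --> 1^'-] --> +oo.
Proof.
move=> q0; apply/cvgryPge => A.
pose B := Num.max 1 A; have B0 : 0 < B by rewrite lt_max ltr01.
near=> z; have z1 : 0 < 1 - z by rewrite subr_gt0.
apply: (@le_trans _ _ B); first by rewrite le_max lexx orbT.
have zB : 1 - z <= B `^ (- q^-1).
  rewrite lerBlDl -lerBlDr; near: z; apply: nbhs_left_ge.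
  by rewrite gtrBl powR_gt0.
rewrite powRN -[leLHS]invrK lef_pV2 ?posrE ?invr_gt0 ?powR_gt0//.
have -> : B^-1 = (B `^ (- q^-1)) `^ q.
  by rewrite -powRrM mulNr mulVf ?gt_eqF// powR_inv1 ?ltW.
by apply: ge0_ler_powR => //; rewrite ?nnegrE ?powR_ge0//; exact: ltW.
Unshelve. all: by end_near. Qed.

Lemma cvg_log_pole : - ln (1 - z : R) @[z --> 1^'-] --> +oo.
Proof.
apply/cvgryPge => A; near=> z; have z1 : 0 < 1 - z by rewrite subr_gt0.
rewrite lerNr -[leRHS](@expRK R); rewrite ler_ln ?posrE ?expR_gt0//.
rewrite lerBlDl -lerBlDr; near: z; apply: nbhs_left_ge.
by rewrite gtrBl expR_gt0.
Unshelve. all: by end_near. Qed.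

(* The Taylor coefficients of 2F1(x + iy, x - iy; p; z). *)
Definition gauss_coef x y p n : R := sqpoch x y n / (poch p n * n`!%:R).

Lemma gauss_coef_ge0 x y p n : 0 < x -> 0 < p -> 0 <= gauss_coef x y p n.
Proof.
move=> x0 p0; rewrite divr_ge0 ?mulr_ge0// ltW//; first exact: sqpoch_gt0.
exact: poch_gt0.
Qed.

Lemma fact_neq0 n : n`!%:R != 0 :> R.
Proof. by rewrite pnatr_eq0 -lt0n fact_gt0. Qed.

(** The comparison series is that of (1 - z)^(-q) with q = 2x - p, chosen so that the ratio of
    coefficients is the one of [sqpoch_ratio_cvg]. *)
Lemma powser_gauss_lt x y p : 0 < x -> 0 < p -> p < x + x ->
  (forall z, 0 < z < 1 -> cvgn (series (fun n => gauss_coef x y p n * z ^+ n))) /\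
  (powser (gauss_coef x y p) z * (1 - z) `^ (x + x - p) @[z --> 1^'-] -->
  gamR p * gamR (x + x - p) / sqnorm (Gamma (x +i* y))).
Proof.
move=> x0 p0 px; have q0 : 0 < x + x - p by rewrite subr_gt0.
pose d n := poch (x + x - p) n / n`!%:R.
have d0 n : 0 < d n by rewrite divr_gt0 ?poch_gt0// ltr0n fact_gt0.
have [||||||h1 h2] := @powser_abelian (gauss_coef x y p) d
  (gamR p * gamR (x + x - p) / sqnorm (Gamma (x +i* y)))
  (fun z => (1 - z) `^ (- (x + x - p))).
- by move=> n; exact: gauss_coef_ge0.
- by move=> n; exact: ltW.
- exact: nearW.
- have := @sqpoch_ratio_cvg R p (x + x - p) x y p0 q0 x0 (subrKC _ _).
  suff -> : (fun n => gauss_coef x y p n / d n) =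
    (fun n => sqpoch x y n / (poch p n * poch (x + x - p) n)) by [].
  apply/funext => n; rewrite /gauss_coef /d; field.
  by rewrite fact_neq0 !gt_eqF// poch_gt0.
- by move=> z /andP[z0 z1]; apply: binomial_series => //; rewrite ltW.
- exact: cvg_bin_pole.
split => //.
suff -> : (fun z => powser (gauss_coef x y p) z * (1 - z) `^ (x + x - p)) =
  (fun z => powser (gauss_coef x y p) z / (1 - z) `^ (- (x + x - p))) by [].
by apply/funext => z; rewrite powRN invrK.
Qed.

Lemma powser_gauss_eq x y : 0 < x ->
  (forall z, 0 < z < 1 ->
    cvgn (series (fun n => gauss_coef x y (x + x) n * z ^+ n))) /\
  (powser (gauss_coef x y (x + x)) z / (- ln (1 - z)) @[z --> 1^'-] -->
  gamR (x + x) / sqnorm (Gamma (x +i* y))).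
Proof.
move=> x0; have xx0 : 0 < x + x by rewrite addr_gt0.
apply: (@powser_abelian (gauss_coef x y (x + x)) (fun n => n%:R^-1)
  (gamR (x + x) / sqnorm (Gamma (x +i* y))) (fun z => - ln (1 - z))).
- by move=> n; exact: gauss_coef_ge0.
- by move=> n; rewrite invr_ge0.
- by exists 1%N => // n /= n1; rewrite invr_gt0 ltr0n.
(* The shift matches the n + 2 factors of Euler's products; dividing by the coefficient 1/(n+2)
   turns the factorial (n+2)! of [gauss_coef] into (n+1)!. *)
- rewrite -(cvg_shiftn 2).
  have -> : (fun n => gauss_coef x y (x + x) (n + 2) / ((n + 2)%:R^-1)) =
    (fun n => (n.+1%:R `^ (x + x) * n.+1`!%:R / poch (x + x) n.+2) /
            ((n.+1%:R `^ x * n.+1`!%:R) ^+ 2 / sqpoch x y n.+2)).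
    apply/funext => n; rewrite addn2 /gauss_coef.
    have p0 := poch_gt0 n.+2 xx0; have s0 := sqpoch_gt0 y n.+2 x0.
    have f0 := fact_neq0 n.+1.
    have xn0 : n.+1%:R `^ x != 0 :> R by rewrite gt_eqF// powR_gt0.
    have m0 : n.+2%:R != 0 :> R by rewrite pnatr_eq0.
    rewrite powRD ?pnatr_eq0 ?implybT// factS natrM.
    move: (n.+1`!%:R : R) (n.+2%:R : R) f0 m0 => f m f0 m0.
    by field; rewrite f0 m0 xn0 !gt_eqF.
  apply: cvgM; first exact: gamR_cvg.
  by apply: cvgV; [rewrite gt_eqF// sqGamma_gt0|exact: sqGamma_cvg].
- by move=> z z01; exact: log_series.
- exact: cvg_log_pole.
Qed.

End power_series.

(** * Gauss's summation theorem *)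

Section gauss_summation.
Context {R : realType}.
Implicit Types (p q x y z : R) (n : nat).

(* The Taylor coefficients of 2F1(1 + x + iy, 1 + x - iy; 2; z), written with
   (a)_(n+1) = a (a + 1)_n so that only the parameters x + iy, x - iy occur. *)
Definition density_coef x y n : R :=
  sqpoch x y n.+1 / ((x ^+ 2 + y ^+ 2) * (n`!%:R * n.+1`!%:R)).

Lemma density_coef_ge0 x y n : 0 < x -> 0 <= density_coef x y n.
Proof.
move=> x0; rewrite divr_ge0//; first by rewrite ltW// sqpoch_gt0.
by rewrite !mulr_ge0// addr_ge0 ?sqr_ge0.
Qed.

Lemma powser_density x y : 0 < x ->
  (forall z, 0 < z < 1 -> cvgn (series (fun n => density_coef x y n * z ^+ n))) /\
  (powser (density_coef x y) z * (1 - z) `^ (x + x) @[z --> 1^'-] -->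
  gamR (x + x) / ((x ^+ 2 + y ^+ 2) * sqnorm (Gamma (x +i* y)))).
Proof.
move=> x0; have xx0 : 0 < x + x by rewrite addr_gt0.
have t0 : 0 < x ^+ 2 + y ^+ 2 by rewrite ltr_pwDl ?exprn_gt0 ?sqr_ge0.
pose d n := poch (x + x) n / n`!%:R.
have d0 n : 0 < d n by rewrite divr_gt0 ?poch_gt0// ltr0n fact_gt0.
have [|||||| h1 h2] := @powser_abelian R (density_coef x y) d
  (gamR (x + x) / ((x ^+ 2 + y ^+ 2) * sqnorm (Gamma (x +i* y))))
  (fun z => (1 - z) `^ (- (x + x))).
- by move=> n; exact: density_coef_ge0.
- by move=> n; exact: ltW.
- exact: nearW.
- rewrite -(cvg_shiftn 1).
  (* The products in [density_coef] and [d] have lengths differing by one; the surplus is (2x + n +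
     1)/(n + 2) = 1 + (2x - 1)/(n + 2), which tends to 1. *)
  have -> : (fun n => density_coef x y (n + 1) / d (n + 1)%N) =
    (fun n => (n.+1%:R `^ (x + x) * n.+1`!%:R / poch (x + x) n.+2) /
       ((x ^+ 2 + y ^+ 2) *
          ((n.+1%:R `^ x * n.+1`!%:R) ^+ 2 / sqpoch x y n.+2)) *
       (1 + (x + x - 1) * n.+2%:R^-1)).
    apply/funext => n; rewrite addn1 /density_coef /d (pochS _ n.+1).
    have p0 := poch_gt0 n.+1 xx0; have s0 := sqpoch_gt0 y n.+2 x0.
    have f0 := @fact_neq0 R n.+1.
    have xn0 : n.+1%:R `^ x != 0 :> R by rewrite gt_eqF// powR_gt0.
    have m0 : n.+2%:R != 0 :> R by rewrite pnatr_eq0.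
    have m1 : 0 < x + x + n.+1%:R by rewrite ltr_wpDr.
    rewrite powRD ?pnatr_eq0 ?implybT// (factS n.+1) natrM.
    have e1 : n.+2%:R = n.+1%:R + 1 :> R by rewrite -[n.+2]addn1 natrD.
    rewrite e1 in m0 *; move: (n.+1`!%:R : R) (n.+1%:R `^ x : R) f0 xn0 => f a f0 a0.
    move: (n.+1%:R : R) m0 m1 => m m0 m1.
    by field; rewrite f0 m0 a0 !gt_eqF.
  rewrite -[gamR (x + x) / _]mulr1; apply: cvgM.
    apply: cvgM; first exact: gamR_cvg.
    apply: cvgV; first by rewrite mulf_neq0// gt_eqF// sqGamma_gt0.
    by apply: cvgM; [exact: cvg_cst|exact: sqGamma_cvg].
  rewrite -[X in _ --> X](_ : 1 + (x + x - 1) * 0 = 1); last by rewrite mulr0 addr0.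
  apply: cvgD; first exact: cvg_cst.
  apply: cvgM; first exact: cvg_cst.
  by have := @cvg_harmonic R; rewrite -cvg_shiftS.
- by move=> z /andP[z0 z1]; apply: binomial_series => //; rewrite ltW.
- exact: cvg_bin_pole.
split => //.
suff -> : (fun z => powser (density_coef x y) z * (1 - z) `^ (x + x)) =
  (fun z => powser (density_coef x y) z / (1 - z) `^ (- (x + x))) by [].
by apply/funext => z; rewrite powRN invrK.
Qed.

Section coefficients.
Variables (x y : R) (x0 : 0 < x).
Local Notation t := (gauss_coef x y).
Local Notation th := (x ^+ 2 + y ^+ 2).

Lemma gauss_coef0 p : t p 0 = 1.
Proof. by rewrite /gauss_coef /sqpoch /poch !big_ord0 !mul1r invr1. Qed.

Lemma gauss_coefS p n : 0 < p ->
  t p n.+1 = t p n * ((x + n%:R) ^+ 2 + y ^+ 2) / ((p + n%:R) * n.+1%:R).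
Proof.
move=> p0; rewrite /gauss_coef sqpochS pochS factS natrM.
have q0 := poch_gt0 n p0; have f0 := @fact_neq0 R n.
have pn0 : 0 < p + n%:R by rewrite ltr_wpDr.
have n0 : n.+1%:R != 0 :> R by rewrite pnatr_eq0.
move: (n.+1%:R : R) (n`!%:R : R) n0 f0 => m f n0 f0.
by field; rewrite f0 n0 !gt_eqF.
Qed.

Lemma gauss_coef_shift p n : 0 < p -> t (p + 1) n = t p n * p / (p + n%:R).
Proof.
move=> p0; have e := pochSl p n; rewrite pochS in e.
have p10 : 0 < p + 1 by rewrite addr_gt0.
have q0 := poch_gt0 n p0; have q1 := poch_gt0 n p10; have f0 := @fact_neq0 R n.
have pn0 : 0 < p + n%:R by rewrite ltr_wpDr.
have -> : t (p + 1) n = sqpoch x y n * p / ((p * poch (p + 1) n) * n`!%:R).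
  by rewrite /gauss_coef; field; rewrite f0 !gt_eqF.
by rewrite -e /gauss_coef; field; rewrite f0 !gt_eqF.
Qed.

(** Since n(p + n) - |x + iy + n|^2 = n(p - 2x) - (x^2 + y^2), the decrement of n t_n is
    asymptotically (p - 2x) t_n. This drives both the contiguous relation and the convergence at
    1. *)
Lemma gauss_coef_diff p n : 0 < p ->
  n%:R * t p n - n.+1%:R * t p n.+1 =
  t p n * ((n%:R * (p - (x + x)) - th) / (p + n%:R)).
Proof.
move=> p0; rewrite gauss_coefS//.
have pn0 : 0 < p + n%:R by rewrite ltr_wpDr.
have n0 : n.+1%:R != 0 :> R by rewrite pnatr_eq0.
move: (n.+1%:R : R) n0 => m n0.
by field; rewrite n0 gt_eqF.
Qed.

(* The partial sums of Gauss's contiguous relation at z = 1 telescope. *)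
Lemma gauss_contiguous p m : 0 < p ->
  p * (p - (x + x)) * series (t p) m =
  ((p - x) ^+ 2 + y ^+ 2) * series (t (p + 1)) m - p * (m%:R * t p m).
Proof.
move=> p0; elim: m => [|m IH].
  by rewrite /series/= !big_geq// !mulr0 mul0r mulr0 subr0.
rewrite !seriesSr mulrDr IH mulrDr gauss_coef_shift//.
have := gauss_coef_diff m p0 => /eqP; rewrite subr_eq => /eqP h.
have -> : m.+1%:R * t p m.+1 = m%:R * t p m -
  t p m * ((m%:R * (p - (x + x)) - th) / (p + m%:R)) by rewrite h; ring.
have pm0 : 0 < p + m%:R by rewrite ltr_wpDr.
by field; rewrite gt_eqF.
Qed.

(** Raabe's test: with d half of p - 2x, eventually d t_n <= D_n - D_(n+1) for D_n = n t_n, so the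
    sum of the t_n telescopes to a finite bound, and D is eventually nonincreasing. *)
Lemma gauss_series_cvg p : x + x < p ->
  cvgn (series (t p)) /\ n%:R * t p n @[n --> \oo] --> 0.
Proof.
move=> px; have p0 : 0 < p by rewrite (lt_trans _ px)// addr_gt0.
pose d := (p - (x + x)) / 2; have d0 : 0 < d by rewrite divr_gt0// subr_gt0.
pose D n := n%:R * t p n.
have t0 n : 0 <= t p n by exact: gauss_coef_ge0.
have D0 n : 0 <= D n by rewrite mulr_ge0.
have th0 : 0 <= th by rewrite addr_ge0 ?sqr_ge0.
(* For n >= N one has n d >= x^2 + y^2 + p d, that is 2 d n - (x^2 + y^2) >= d (p + n). *)
pose N := (Num.bound ((th + p * d) / d)).+1.
have DN n : (N <= n)%N -> d * t p n <= D n - D n.+1.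
  move=> Nn; rewrite /D gauss_coef_diff// mulrC ler_wpM2l//.
  have pn0 : 0 < p + n%:R by rewrite ltr_wpDr.
  rewrite ler_pdivlMr//.
  have : (th + p * d) / d <= n%:R.
    rewrite ltW// (lt_le_trans (archi_boundP _)) ?ler_nat ?(ltnW Nn)//.
    by rewrite divr_ge0 ?(ltW d0)// addr_ge0// mulr_ge0// ltW.
  rewrite ler_pdivrMr// => h.
  have -> : p - (x + x) = 2 * d by rewrite /d; field.
  by lra.
have Dmono m n : (N <= m)%N -> (m <= n)%N -> D n <= D m.
  move=> Nm; elim: n => [|n IH]; first by rewrite leqn0 => /eqP ->.
  rewrite leq_eqVlt => /orP[/eqP -> //|]; rewrite ltnS => mn.
  apply: le_trans (IH mn); rewrite -subr_ge0 (le_trans _ (DN n _))//.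
    by rewrite mulr_ge0// ltW.
  exact: leq_trans mn.
have cS : cvgn (series (t p)).
  apply: (@is_cvg_series_bound _ _ (series (t p) N + D N / d)) => //.
  exists N => // m /= Nm.
  rewrite -lerBlDl sub_series_geq// ler_pdivlMr// mulr_suml.
  apply: (@le_trans _ _ (\sum_(N <= i < m) (D i - D i.+1))).
    rewrite big_nat_cond [leRHS]big_nat_cond; apply: ler_sum => i.
    by move=> /andP[/andP[Ni _] _]; rewrite mulrC DN.
  under eq_bigr do rewrite -opprB.
  by rewrite sumrN telescope_sumr// opprB gerBl.
split => //; apply/cvgrPdist_le => e e0.
have e40 : 0 < e / 4 by rewrite divr_gt0.
have [M _ HM] : \forall n \near \oo, `|limn (series (t p)) - series (t p) n| <= e / 4.
  by have /cvgrPdist_le := cS; apply.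
exists (maxn M N).*2.+2 => // n /= Hn.
have n0 : (0 < n)%N by apply: leq_trans Hn.
have hn2 : (maxn M N < n./2)%N by move: Hn; lia.
have Mn2 : (M <= n./2)%N by apply: leq_trans (ltnW hn2); exact: leq_maxl.
have Nn2 : (N <= n./2)%N by apply: leq_trans (ltnW hn2); exact: leq_maxr.
have n2n : (n./2 <= n)%N by lia.
rewrite sub0r normrN ger0_norm ?D0// -/(D n).
have h1 := HM _ Mn2; have h2 := HM _ (leq_trans Mn2 n2n).
(* At least n/2 indices i lie between n/2 and n, and each has t_i = D_i/i >= D_n/n. Both partial
   sums being within e/4 of the limit, D_n <= e follows. *)
suff h3 : D n / 2 <= series (t p) n - series (t p) n./2.
  move: h1 h2; rewrite !ler_norml => /andP[h1 h1'] /andP[h2 h2']; lra.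
rewrite sub_series_geq//.
apply: (@le_trans _ _ (\sum_(n./2 <= i < n) D n / n%:R)).
  rewrite big_const_nat iter_addr addr0 -[_ *+ (n - _)]mulr_natr -mulrA ler_wpM2l//.
  rewrite -[leRHS]mulrC ler_pdivlMr ?ltr0n// mulrC ler_pdivrMr// -natrM ler_nat.
  by lia.
rewrite big_nat_cond [leRHS]big_nat_cond; apply: ler_sum => i.
move=> /andP[/andP[ni iltn] _].
have i0 : (0 < i)%N by rewrite (leq_trans _ ni)// (leq_trans _ hn2).
have Di : D n <= D i by apply: Dmono; [exact: leq_trans ni|exact: ltnW].
rewrite ler_pdivrMr ?ltr0n// (le_trans Di)// /D mulrC ler_wpM2l// ler_nat ltnW//.
Qed.

Lemma gauss_series_contiguous p : x + x < p ->
  p * (p - (x + x)) * limn (series (t p)) =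
  ((p - x) ^+ 2 + y ^+ 2) * limn (series (t (p + 1))).
Proof.
move=> px; have p0 : 0 < p by rewrite (lt_trans _ px)// addr_gt0.
have [h1 hD] := gauss_series_cvg px.
have px1 : x + x < p + 1 by rewrite (lt_trans px)// ltrDl.
have [h2 _] := gauss_series_cvg px1.
have l1 : p * (p - (x + x)) * series (t p) m @[m --> \oo] -->
    p * (p - (x + x)) * limn (series (t p)).
  by apply: cvgM => //; exact: cvg_cst.
have l2 : ((p - x) ^+ 2 + y ^+ 2) * series (t (p + 1)) m - p * (m%:R * t p m)
    @[m --> \oo] --> ((p - x) ^+ 2 + y ^+ 2) * limn (series (t (p + 1))) - p * 0.
  apply: cvgB; first by apply: cvgM => //; exact: cvg_cst.
  by apply: cvgM => //; exact: cvg_cst.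
rewrite -(cvg_lim _ l1)//; under eq_fun do rewrite gauss_contiguous//.
by rewrite (cvg_lim _ l2)// mulr0 subr0.
Qed.

Lemma gauss_series_iter p n : x + x < p ->
  limn (series (t p)) = sqpoch (p - x) y n / (poch p n * poch (p - (x + x)) n) *
    limn (series (t (p + n%:R))).
Proof.
move=> px; have p0 : 0 < p by rewrite (lt_trans _ px)// addr_gt0.
have q0 : 0 < p - (x + x) by rewrite subr_gt0.
elim: n => [|n IH].
  by rewrite /sqpoch /poch !big_ord0 !mul1r invr1 mul1r addr0.
have pn : x + x < p + n%:R by rewrite (lt_le_trans px)// lerDl.
have := gauss_series_contiguous pn.
have -> : p + n%:R + 1 = p + n.+1%:R by rewrite -[n.+1]addn1 natrD addrA.
rewrite IH sqpochS !pochS => E.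
have pn0 : 0 < p + n%:R by rewrite (lt_trans _ pn)// addr_gt0.
have qn0 : 0 < p - (x + x) + n%:R by rewrite ltr_wpDr.
have P0 := poch_gt0 n p0; have Q0 := poch_gt0 n q0.
have -> : limn (series (t (p + n%:R))) = (((p + n%:R - x) ^+ 2 + y ^+ 2) *
    limn (series (t (p + n.+1%:R)))) / ((p + n%:R) * (p + n%:R - (x + x))).
  rewrite -E mulrAC mulfV ?mul1r// mulf_neq0// gt_eqF//.
  by rewrite subr_gt0.
rewrite [p - x + _]addrAC [p - (x + x) + _]addrAC.
rewrite [p - (x + x) + _]addrAC in qn0.
move: (limn _) => L.
by field; rewrite !gt_eqF.
Qed.

(** The constant term is 1. In degree m + 1, the first factor of the Pochhammer denominator improves
    from p to q = p + n and the others do not decrease, so the rest of the series shrinks at least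
    by p/q and tends to 0. *)
Lemma gauss_series_bounds p n : x + x < p ->
  1 <= limn (series (t (p + n%:R))) <=
  1 + p / (p + n%:R) * (limn (series (t p)) - 1).
Proof.
move=> px; have p0 : 0 < p by rewrite (lt_trans _ px)// addr_gt0.
set q := p + n%:R; have pq : p <= q by rewrite lerDl.
have q0 : 0 < q by rewrite (lt_le_trans p0).
have [cp _] := gauss_series_cvg px.
have [cq _] := gauss_series_cvg (lt_le_trans px pq).
have t_ge0 r m : 0 < r -> 0 <= t r m by exact: gauss_coef_ge0.
have tS m : t q m.+1 <= p / q * t p m.+1.
  rewrite /gauss_coef !pochSl.
  have p10 : 0 < p + 1 by rewrite addr_gt0.
  have q10 : 0 < q + 1 by rewrite addr_gt0.
  have P0 := poch_gt0 m p10; have Q0 := poch_gt0 m q10.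
  have f0 : 0 < m.+1`!%:R :> R by rewrite ltr0n fact_gt0.
  have -> : p / q * (sqpoch x y m.+1 / (p * poch (p + 1) m * m.+1`!%:R)) =
      sqpoch x y m.+1 / (q * poch (p + 1) m * m.+1`!%:R).
    by move: (m.+1`!%:R : R) f0 => f f0; field; rewrite !gt_eqF.
  rewrite ler_wpM2l ?(ltW (sqpoch_gt0 y m.+1 x0))//.
  rewrite lef_pV2 ?posrE ?mulr_gt0// ler_wpM2r ?(ltW f0)// ler_wpM2l ?(ltW q0)//.
  apply: ler_prod => i _; rewrite lerD2r lerD2r pq andbT.
  by rewrite addr_ge0// ltW.
have le1 : \forall m \near \oo, 1 <= series (t q) m.
  exists 1%N => // m /= m1.
  rewrite /series/= big_ltn// gauss_coef0 lerDl; apply: sumr_ge0 => i _.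
  exact: t_ge0.
apply/andP; split; first exact: limr_ge.
have lr : 1 + p / q * (series (t p) m - 1) @[m --> \oo] -->
    1 + p / q * (limn (series (t p)) - 1).
  apply: cvgD; first exact: cvg_cst.
  apply: cvgM; first exact: cvg_cst.
  by apply: cvgB => //; exact: cvg_cst.
rewrite -(cvg_lim _ lr)//; apply: ler_lim => //.
  by apply/cvg_ex; eexists; exact: lr.
exists 1%N => // -[//|m] _ /=.
rewrite /series/= !big_nat_recl//= !gauss_coef0 lerD2l addrAC subrr add0r.
by rewrite mulr_sumr; apply: ler_sum => i _; exact: tS.
Qed.

(** Let n grow in [gauss_series_iter]: the remaining series tends to 1, and the product in front
    converges because its lower parameters satisfy p + (p - 2x) = 2(p - x). *)
Lemma gauss_summation p : x + x < p ->
  series (t p) @ \oo --> gamR p * gamR (p - (x + x)) /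
    sqnorm (Gamma ((p - x) +i* y)).
Proof.
move=> px; have p0 : 0 < p by rewrite (lt_trans _ px)// addr_gt0.
have q0 : 0 < p - (x + x) by rewrite subr_gt0.
have px0 : 0 < p - x by rewrite subr_gt0 (lt_trans _ px)// ltrDl.
have [cp _] := gauss_series_cvg px.
suff <- : limn (series (t p)) = gamR p * gamR (p - (x + x)) /
    sqnorm (Gamma ((p - x) +i* y)) by [].
have lim1 : limn (series (t (p + n%:R))) @[n --> \oo] --> (1 : R).
  have h : 1 + p / (p + n%:R) * (limn (series (t p)) - 1) @[n --> \oo] --> (1 : R).
    rewrite -[X in _ --> X](_ : 1 + p * 0 * (limn (series (t p)) - 1) = 1); last first.
      by rewrite mulr0 mul0r addr0.
    apply: cvgD; first exact: cvg_cst.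
    apply: cvgM; last exact: cvg_cst.
    apply: cvgM; first exact: cvg_cst.
    rewrite -(cvg_shiftn 1); apply: (squeeze_cvgr _ (cvg_cst 0) cvg_harmonic).
    apply: nearW => n /=; rewrite addn1 invr_ge0 addr_ge0 ?(ltW p0)//=.
    by rewrite lef_pV2 ?posrE ?addr_gt0// lerDr ltW.
  apply: (squeeze_cvgr _ (cvg_cst (1 : R)) h).
  by apply: nearW => n; exact: gauss_series_bounds.
have pq : p + (p - (x + x)) = (p - x) + (p - x) by ring.
have l2 : sqpoch (p - x) y n / (poch p n * poch (p - (x + x)) n) *
    limn (series (t (p + n%:R))) @[n --> \oo] -->
    gamR p * gamR (p - (x + x)) / sqnorm (Gamma ((p - x) +i* y)) * 1.
  by apply: cvgM => //; exact: sqpoch_ratio_cvg.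
rewrite mulr1 in l2; rewrite -(cvg_lim _ l2)//.
apply/esym/cvg_lim => //.
under eq_fun do rewrite -(gauss_series_iter _ px).
exact: cvg_cst.
Qed.

(** Convergence comes from the comparison theorems when p <= 2x and from convergence at z = 1 when p
    > 2x. *)
Lemma powser_gauss_cvg p z : 0 < p -> 0 < z < 1 ->
  cvgn (series (fun n => t p n * z ^+ n)).
Proof.
move=> p0 z01; have [px|px|->] := ltgtP p (x + x).
- by have [h _] := powser_gauss_lt y x0 p0 px; exact: h.
- have [h _] := gauss_series_cvg px; have /andP[z0 z1] := z01.
  apply: series_le_cvg h => n; have h0 := gauss_coef_ge0 y n x0 p0.
  + by rewrite mulr_ge0// exprn_ge0// ltW.
  + by [].
  + by rewrite ler_piMr// exprn_ile1// ltW.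
- by have [h _] := powser_gauss_eq y x0; exact: h.
Qed.

End coefficients.

End gauss_summation.

(** * Density measures and complex-valued limits *)

Section density_integral.
Context {R : realType}.
Local Notation mu := (@lebesgue_measure R).
Import HBNNSimple.
Implicit Types (f : R -> R[i]) (g : measurableTypeR R -> \bar R).

Lemma integral_density_nnsfun f (h : {nnsfun (measurableTypeR R) >-> R}) :
  (\int[density_measure f]_x (h x)%:E =
   \int[mu]_x ((h x)%:E * (density_fun f x)%:E))%E.
Proof.
have mw : measurable_fun setT (EFin \o density_fun f).
  by apply/measurable_EFinP; exact: measurable_density_fun.
have w0 x : (0 <= (density_fun f x)%:E)%E by rewrite lee_fin density_fun_ge0.
rewrite integralT_nnsfun sintegralE.
under [RHS]eq_integral => x _.
  rewrite fimfunE -fsumEFin// ge0_mule_fsuml; last first.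
    by move=> y; rewrite nnfun_muleindic_ge0.
  over.
rewrite ge0_integral_fsum//; last 2 first.
- move=> y; apply: emeasurable_funM => //.
  by apply/measurable_EFinP; exact: measurable_funM.
- by move=> y x _; rewrite mule_ge0// nnfun_muleindic_ge0.
apply: eq_fsbigr => y; rewrite inE => -[x0 _ <-{y}].
under eq_integral do rewrite EFinM -muleA.
have mh : measurable (h @^-1` [set h x0]) by [].
rewrite ge0_integralZl ?lee_fin//; last 2 first.
- by apply: emeasurable_funM => //; apply/measurable_EFinP.
- by move=> x _; rewrite mule_ge0// lee_fin.
congr (_ * _)%E; rewrite [LHS]integral_mkcond; apply: eq_integral => x _.
by rewrite epatch_indic muleC.
Qed.

(** From simple functions to [g] by a nondecreasing approximation; the weight being nonnegative,
    monotone convergence applies to both integrals. *)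
Lemma ge0_integral_density_measure f g (D : set (measurableTypeR R)) :
  measurable D -> measurable_fun D g -> (forall x, D x -> (0 <= g x)%E) ->
  (\int[density_measure f]_(x in D) g x =
   \int[mu]_(x in D) (g x * (density_fun f x)%:E))%E.
Proof.
move=> mD mg g0; pose h := nnsfun_approx mD mg.
have mw : measurable_fun setT (EFin \o density_fun f).
  by apply/measurable_EFinP; exact: measurable_density_fun.
have w0 x : (0 <= (density_fun f x)%:E)%E by rewrite lee_fin density_fun_ge0.
have mh n : measurable_fun setT (EFin \o h n) by apply/measurable_EFinP.
have hg x : D x -> (EFin \o h n) x @[n --> \oo] --> g x.
  by move=> Dx; exact: cvg_nnsfun_approx.
transitivity (limn (fun n => \int[density_measure f]_(x in D) (h n x)%:E)%E).
  under eq_integral => x /[!inE] Dx do rewrite -(cvg_lim _ (hg x Dx))//.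
  apply: monotone_convergence => //.
  - by move=> n; exact: measurable_funTS.
  - by move=> n x _; rewrite lee_fin.
  - by move=> x _ a b ab; rewrite lee_fin; exact/lefP/nd_nnsfun_approx.
transitivity (limn (fun n => \int[mu]_(x in D) ((h n x)%:E * (density_fun f x)%:E))%E); last first.
  have hgw x : D x -> ((EFin \o h n) x * (density_fun f x)%:E)%E @[n --> \oo] -->
      (g x * (density_fun f x)%:E)%E.
    by move=> Dx; apply: cvgeZr => //; exact: hg.
  under [RHS]eq_integral => x /[!inE] Dx do rewrite -(cvg_lim _ (hgw x Dx))//.
  apply/esym/monotone_convergence => //.
  - by move=> n; apply: measurable_funTS; exact: emeasurable_funM.
  - by move=> n x _; rewrite mule_ge0// lee_fin.
  - by move=> x _ a b ab; rewrite lee_wpmul2r// lee_fin; exact/lefP/nd_nnsfun_approx.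
congr (limn _); apply/funext => n.
(* Cutting the simple function off outside [D] gives another simple function, to which the identity
   on the whole line applies. *)
pose k : {nnsfun (measurableTypeR R) >-> R} := proj_nnsfun (h n) mD.
have := integral_density_nnsfun f k.
rewrite [LHS]integral_mkcond [RHS]integral_mkcond => kE.
transitivity (\int[density_measure f]_x (k x)%:E)%E.
  rewrite integral_mkcond; apply: eq_integral => x _.
  by rewrite epatch_indic.
rewrite [LHS]integral_mkcond kE -integral_mkcond.
rewrite [RHS]integral_mkcond; apply: eq_integral => x _.
by rewrite epatch_indic/= EFinM muleAC.
Qed.

End density_integral.

Section complex_limits.
Context {R : realType}.

Lemma cvg_real_complex {T : Type} (F : set_system T) {FF : Filter F}
    (f : T -> R) (l : R) : f @ F --> l -> (f x)%:C @[x --> F] --> l%:C.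
Proof.
move=> fl; apply/cvgrPdist_lt => e e0.
(* In the order of [R[i]], 0 < e forces e to be real, so its real part is a valid tolerance in
   [R]. *)
have eE : e = (complex.Re e)%:C.
  by move: e0; rewrite ltcE/= => /andP[/eqP e0 _]; case: e e0 => a b /= ->.
have Re0 : 0 < complex.Re e by move: e0; rewrite ltcE => /andP[].
move/cvgrPdist_lt : fl => /(_ _ Re0); apply: filterS => x h.
rewrite -rmorphB/= eE normc_def/= expr0n addr0 sqrtr_sqr ltcR//.
Qed.

Lemma limn_real_complex (u : R^nat) (l : R) : u @ \oo --> l ->
  limn (fun n => (u n)%:C : R[i]) = l%:C.
Proof.
move=> ul; apply: cvg_lim; first exact: norm_hausdorff.
exact: cvg_real_complex.
Qed.

(** Inside the unit disc only the Gauss series is involved. With alpha = x + iy, (1 + alpha)_k =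
    (alpha)_(k+1)/alpha, and multiplying by the conjugate gives |(alpha)_(k+1)|^2/|alpha|^2; also
    (2)_k = (k+1)!. *)
Lemma hyp2F1_real (x y z : R) : 0 < x -> 0 < z < 1 ->
  hyp2F1 (1 + (x +i* y)^*) (1 + (x +i* y)) 2 z%:C =
  (powser (density_coef x y) z)%:C :> R[i].
Proof.
move=> x0 z01; have /andP[z0 z1] := z01; have [cz _] := powser_density y x0.
rewrite /hyp2F1 normc_def/= expr0n addr0 sqrtr_sqr ltcR (gtr0_norm z0) z1.
rewrite /gauss_series.
suff -> : series (gauss_term (1 + (x +i* y)^*) (1 + (x +i* y)) 2 z%:C) =
    (fun n => (series (fun n => density_coef x y n * z ^+ n) n)%:C : R[i]).
  exact: limn_real_complex (cz z z01).
apply/funext => n; rewrite /series/= rmorph_sum; apply: eq_bigr => k _.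
rewrite /gauss_term.
have e1 : \prod_(j < k) (1 + (x +i* y)^* + j%:R) *
    \prod_(j < k) (1 + (x +i* y) + j%:R) =
    (sqpoch x y k.+1 / (x ^+ 2 + y ^+ 2))%:C.
  have -> : \prod_(j < k) (1 + (x +i* y)^* + j%:R) =
      (\prod_(j < k) (1 + (x +i* y) + j%:R))^*.
    by rewrite rmorph_prod/=; apply: eq_bigr => j _; rewrite !rmorphD/= rmorph1 rmorph_nat.
  rewrite mulrC -sqr_normc -sqnormE.
  have -> : 1 + (x +i* y) = (x + 1) +i* y.
    by apply/eqP; rewrite eq_complex/= add0r addrC !eqxx.
  rewrite sqnorm_prod; congr (_%:C).
  rewrite /sqpoch big_ord_recl/= addr0 mulrC mulKf; last first.
    by rewrite gt_eqF// ltr_pwDl ?exprn_gt0 ?sqr_ge0.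
  by apply: eq_bigr => j _; rewrite /bump/= natrD addrA.
have e2 : \prod_(j < k) (2 + j%:R) = (k.+1`!%:R)%:C :> R[i].
  have := @pochSl R 1 k; rewrite poch1 mul1r => ->.
  rewrite -prod_real; apply: eq_bigr => j _.
  by rewrite rmorphD/= rmorph1 -natrD.
rewrite e1 e2 /density_coef.
rewrite -(rmorph_nat (real_complex R) k`!).
move: (k`!%:R : R) (k.+1`!%:R : R) => a b.
rewrite -!rmorphM -fmorphV -rmorphXn -!rmorphM.
by congr (_%:C); rewrite /= !invfM; ring.
Qed.

End complex_limits.

(** * Moments of the solution *)

Section moments.
Context {R : realType}.
Local Notation mu := (@lebesgue_measure R).
Local Notation Rp := (`]0%R, +oo[%classic : set R).
Implicit Types (g theta t r s w e : R).

(* The sign of [w] plays no role: everything is symmetric in the two conjugate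
   parameters. *)
Lemma sqrtC_neg theta : 1 < theta ->
  exists2 w, sqrtC (1 - theta)%:C = 0 +i* w & w ^+ 2 = theta - 1.
Proof.
move=> th1; have := sqrtCK (1 - theta)%:C.
case: (sqrtC _) => a b /eqP; rewrite expr2 eq_complex/= => /andP[/eqP h1 /eqP h2].
have ab : a * b = 0 by move: h2; rewrite [b * a]mulrC; lra.
have b0 : b != 0.
  by apply: contraTneq th1 => b0; rewrite -leNgt; move: h1; rewrite b0; nra.
have a0 : a = 0 by move/eqP: ab; rewrite mulf_eq0 (negbTE b0) orbF => /eqP.
by exists b; [rewrite a0|move: h1; rewrite a0; lra].
Qed.

Lemma divc_real (a b g : R) : (a +i* b) / g%:C = (a / g) +i* (b / g).
Proof.
rewrite -fmorphV; apply/eqP; rewrite eq_complex/=.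
by apply/andP; split; apply/eqP; ring.
Qed.

Variables (g theta w : R) (g0 : 0 < g) (th1 : 1 < theta).
Hypothesis wE : sqrtC (1 - theta)%:C = 0 +i* w.
Hypothesis w2 : w ^+ 2 = theta - 1.
Local Notation x := (g^-1).
Local Notation y := (w / g).

Lemma sigma1_div : sigma1 theta / g%:C = (x +i* y)^*.
Proof.
rewrite /sigma1 wE.
have -> : 1 - (0 +i* w) = 1 +i* (- w) :> R[i].
  by apply/eqP; rewrite eq_complex/= subr0 sub0r !eqxx.
by rewrite divc_real mul1r mulNr.
Qed.

Lemma sigma2_div : sigma2 theta / g%:C = x +i* y.
Proof.
rewrite /sigma2 wE.
have -> : 1 + (0 +i* w) = 1 +i* w :> R[i].
  by apply/eqP; rewrite eq_complex/= addr0 add0r !eqxx.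
by rewrite divc_real mul1r.
Qed.

Lemma sqnorm_sigma : x ^+ 2 + y ^+ 2 = theta / g ^+ 2.
Proof.
by rewrite expr_div_n w2; field; rewrite gt_eqF.
Qed.

Lemma heaviside_pos e s : 0 < e ->
  (0 < 1 - e `^ g^-1 * s) = (s < e `^ (- g^-1)).
Proof.
move=> e0; rewrite subr_gt0 powRN -[in RHS](mul1r (_^-1)).
by rewrite ltr_pdivlMr ?powR_gt0// mulrC.
Qed.

Lemma cutoff_powR e s : 0 < e -> 0 < s ->
  (s / e `^ (- g^-1)) `^ g = e * s `^ g.
Proof.
move=> e0 s0; rewrite powRN invrK powRM ?powR_ge0 ?(ltW s0)// -powRrM.
by rewrite mulVf ?gt_eqF// powRr1 ?(ltW e0)// mulrC.
Qed.

Lemma cutoff_lt1 e s : 0 < e -> 0 < s -> s < e `^ (- g^-1) -> e * s `^ g < 1.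
Proof.
move=> e0 s0 sN; rewrite -cutoff_powR//.
rewrite [ltRHS](_ : 1 = 1 `^ g); last by rewrite powR1.
apply: gt0_ltr_powR => //; rewrite ?nnegrE ?divr_ge0 ?powR_ge0 ?(ltW s0)//.
by rewrite ltr_pdivrMr ?powR_gt0// mul1r.
Qed.

Definition gauss_arg t s : R := g * t * (1 + (g * t - 1) * s `^ g).

Lemma gauss_argE t s :
  gauss_arg t s = g * t * (1 - (1 - g * t) * s `^ g).
Proof. by rewrite /gauss_arg; ring. Qed.

(** Both the position of the Dirac mass and the right end of the support of the density. *)
Definition cutoff t : R := (1 - g * t) `^ (- g^-1).

Section fixed_time.
Variables (t : R) (t0 : 0 < t) (t1 : t < g^-1).
Local Notation e := (1 - g * t).
Local Notation N := (cutoff t).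

Lemma gt_gt0 : 0 < g * t. Proof. exact: mulr_gt0. Qed.

Lemma gt_lt1 : g * t < 1.
Proof. by rewrite mulrC -ltr_pdivlMr// mul1r. Qed.

Lemma e_gt0 : 0 < e. Proof. by rewrite subr_gt0 gt_lt1. Qed.

Lemma gauss_arg_itv s : 0 < s -> s < N -> 0 < gauss_arg t s < 1.
Proof.
move=> s0 sN; have h := cutoff_lt1 e_gt0 s0 sN.
have h0 : 0 <= e * s `^ g by rewrite mulr_ge0 ?powR_ge0// ltW// e_gt0.
have h2 := gt_gt0; have h3 := gt_lt1.
rewrite gauss_argE; apply/andP; split; first by rewrite mulr_gt0 ?subr_gt0.
by nra.
Qed.

Let K := theta * e `^ (2 / g) * t.

Let K0 : 0 < K.
Proof. by rewrite !mulr_gt0 ?powR_gt0 ?e_gt0// (lt_trans _ th1). Qed.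

Definition density_real s : R :=
  if s < N then K * powser (density_coef x y) (gauss_arg t s) else 0.

Lemma u_densityE s : 0 < s -> u_density g theta t s = (density_real s)%:C.
Proof.
move=> s0; rewrite /u_density /heaviside heaviside_pos ?e_gt0// -/N /density_real.
case: ifPn => sN; last by rewrite rmorph0 mulr0.
rewrite rmorph1 mulr1 sigma1_div sigma2_div -/(gauss_arg t s).
by rewrite hyp2F1_real ?invr_gt0 ?gauss_arg_itv// -rmorphM.
Qed.

Lemma density_series_cvg s : 0 < s < N ->
  series (fun n => density_coef x y n * gauss_arg t s ^+ n) @ \oo -->
  powser (density_coef x y) (gauss_arg t s).
Proof.
move=> /andP[s0 sN]; have x0 : 0 < x by rewrite invr_gt0.
by have [h _] := powser_density y x0; apply: h; exact: gauss_arg_itv.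
Qed.

Lemma density_real_ge0 s : 0 < s -> 0 <= density_real s.
Proof.
move=> s0; rewrite /density_real; case: ifPn => // sN.
have sI : 0 < s < N by rewrite s0.
rewrite mulr_ge0 ?(ltW K0)//; apply: limr_ge.
  by apply/cvg_ex; eexists; exact: density_series_cvg sI.
apply: nearW => n; apply: sumr_ge0 => i _.
rewrite mulr_ge0 ?density_coef_ge0 ?invr_gt0// exprn_ge0//.
by have /andP[/ltW] := gauss_arg_itv s0 sN.
Qed.

Lemma measurable_gauss_arg : measurable_fun setT (gauss_arg t).
Proof.
apply: measurable_funM => //; apply: measurable_funD => //.
by apply: measurable_funM => //; exact: measurable_powR.
Qed.

(** The power series is known only as a limit, so measurability is inherited from its partial sums
    cut off at [N]. *)
Lemma measurable_density_real : measurable_fun Rp density_real.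
Proof.
pose h (n : nat) (s : R) : R :=
  K * (\sum_(0 <= i < n) density_coef x y i * gauss_arg t s ^+ i) *
  \1_(`]-oo, N[%classic : set R) s.
apply: (@measurable_fun_cvg _ _ _ Rp h).
- move=> n; apply: measurable_funTS; apply: measurable_funM => //.
    apply: measurable_funM => //; apply: measurable_sum => i.
    by apply: measurable_funM => //; apply: measurable_funX; exact: measurable_gauss_arg.
- move=> s /=; rewrite in_itv/= andbT => s0; rewrite /h /density_real indicE.
  have -> : (s \in (`]-oo, N[%classic : set R)) = (s < N) by rewrite mem_setE in_itv.
  case: ifPn => sN.
    under eq_fun do rewrite mulr1.
    by apply: cvgM; [exact: cvg_cst|apply: density_series_cvg; rewrite s0].
  by under eq_fun do rewrite mulr0; exact: cvg_cst.
Qed.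

(** This discharges the guard in [density_fun], which would otherwise replace the density by 0. *)
Lemma is_density_u : is_density (u_density g theta t).
Proof.
split; last by move=> s s0; rewrite u_densityE// ler0c density_real_ge0.
apply: (eq_measurable_fun density_real) measurable_density_real => s.
by rewrite inE /= in_itv/= andbT => s0; rewrite u_densityE.
Qed.

Lemma density_funE s : 0 < s -> density_fun (u_density g theta t) s = density_real s.
Proof.
move=> s0; rewrite /density_fun s0 andbT.
by case: asboolP => [_|/(_ is_density_u)//]; rewrite u_densityE.
Qed.

Variables (r : R) (r0 : 0 < r).
Local Notation p := ((r + 1) / g).
Local Notation gc := (gauss_coef x y p).

Let N0 : 0 < N. Proof. by rewrite powR_gt0 ?e_gt0. Qed.

Lemma density_weight_ge0 n : 0 <= K * density_coef x y n * (g * t) ^+ n.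
Proof.
apply: mulr_ge0; last by apply: exprn_ge0; exact: ltW gt_gt0.
apply: mulr_ge0; first exact: ltW K0.
by apply: density_coef_ge0; rewrite invr_gt0.
Qed.

(** The Beta integral supplies n!/(g (p)_(n+1)). The factor theta of [K] cancels x^2 + y^2 =
    theta/g^2, leaving g t, which raises the degree from n to n + 1: the density yields the moment
    series without its constant term. *)
Lemma density_term_integral n :
  (\int[mu]_(s in `]0%R, N[) (K * density_coef x y n * (g * t) ^+ n *
     (s `^ r * (1 - (s / N) `^ g) ^+ n))%:E =
   (e `^ ((1 - r) / g) * (gc n.+1 * (g * t) ^+ n.+1))%:E)%E.
Proof.
have x0 : 0 < x by rewrite invr_gt0.
have r10 : 0 < r + 1 by rewrite addr_gt0.
have [i1] := @integral_Re_cpowR_onem R 1 (r + 1)%:C g N n N0 g0 r10.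
have E s : complex.Re (1 * cpowR s ((r + 1)%:C - 1)) = s `^ r.
  by rewrite mul1r -(rmorph1 (real_complex R)) -rmorphB cpowR_real/= addrK.
under eq_integral do rewrite E.
move=> I1.
have mf : measurable_fun (`]0, N[%classic : set R)
    (fun s => (s `^ r * (1 - (s / N) `^ g) ^+ n)%:E).
  apply/measurable_EFinP; apply: measurable_funTS; apply: measurable_funM.
    exact: measurable_powR.
  apply: measurable_funX; apply: measurable_funB => //.
  apply: (measurableT_comp (measurable_powR g)).
  exact: measurable_funM.
under eq_integral do rewrite EFinM.
rewrite ge0_integralZl//; last 2 first.
- move=> s /=; rewrite in_itv/= => /andP[s0 sN].
  rewrite lee_fin mulr_ge0 ?powR_ge0// exprn_ge0// cutoff_powR ?e_gt0// subr_ge0.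
  by rewrite ltW// cutoff_lt1// e_gt0.
- by rewrite lee_fin density_weight_ge0.
rewrite integral_itv_bndo_bndc// I1 -EFinM; congr EFin.
have -> m : \prod_(k < m) ((r + 1)%:C + k%:R * g%:C) = (g ^+ m * poch p m)%:C.
  elim: m => [|m IH]; first by rewrite /poch !big_ord0 expr0 mul1r.
  rewrite big_ord_recr/= IH pochS exprS -(rmorph_nat (real_complex R)).
  rewrite -rmorphM -rmorphD -rmorphM; congr (_%:C).
  by rewrite /=; field; rewrite gt_eqF.
rewrite mul1r cpowR_real -(rmorph_nat (real_complex R)) -rmorphXn -!rmorphM.
rewrite -fmorphV -!rmorphM/=.
rewrite /K /density_coef /gauss_coef sqnorm_sigma.
have -> : N `^ (r + 1) = e `^ (- (r + 1) / g).
  by rewrite /cutoff -powRrM; congr (_ `^ _); field; rewrite gt_eqF.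
have -> : e `^ ((1 - r) / g) = e `^ (2 / g) * e `^ (- (r + 1) / g).
  rewrite -powRD; last by rewrite (gt_eqF e_gt0) implybT.
  by congr (_ `^ _); field; rewrite gt_eqF.
have p0 : 0 < p by rewrite divr_gt0.
have P0 := poch_gt0 n.+1 p0.
have f0 := @fact_neq0 R n; have f1 := @fact_neq0 R n.+1.
have thn0 : theta != 0 by rewrite gt_eqF// (lt_trans _ th1).
have gn0 : g ^+ n != 0 by rewrite expf_neq0// gt_eqF.
rewrite !exprS exprMn.
move: (n`!%:R : R) (n.+1`!%:R : R) (g ^+ n) (t ^+ n) f0 f1 gn0 => a b c d a0 b0 c0.
move: (poch _ _) P0 (sqpoch _ _ _) (e `^ _) (e `^ _) => P P0 sq e1 e2.
by field; rewrite a0 b0 c0 thn0 !gt_eqF.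
Qed.

Lemma gauss_tail_cvg : series (fun n => gc n.+1 * (g * t) ^+ n.+1) @ \oo -->
  powser gc (g * t) - 1.
Proof.
have x0 : 0 < x by rewrite invr_gt0.
have p0 : 0 < p by rewrite divr_gt0// addr_gt0.
have z01 : 0 < g * t < 1 by rewrite gt_gt0 gt_lt1.
have h : series (fun n => gc n * (g * t) ^+ n) @ \oo --> powser gc (g * t).
  exact: powser_gauss_cvg.
pose U : R^nat := series (fun n => gc n * (g * t) ^+ n).
have {}h : U (n + 1)%N @[n --> \oo] --> powser gc (g * t) by rewrite cvg_shiftn.
have -> : series (fun n => gc n.+1 * (g * t) ^+ n.+1) = (fun n => U (n + 1)%N - 1).
  apply/funext => n; rewrite addn1 /U /series/= big_nat_recl//=.
  by rewrite gauss_coef0 expr0 mulr1 addrAC subrr add0r.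
by apply: cvgB => //; exact: cvg_cst.
Qed.

Lemma density_moment :
  (\int[density_measure (u_density g theta t)]_(s in Rp) (s `^ r)%:E =
   (e `^ ((1 - r) / g) * (powser gc (g * t) - 1))%:E)%E.
Proof.
rewrite ge0_integral_density_measure//; last 2 first.
- apply/measurable_EFinP; apply: measurable_funTS; exact: measurable_powR.
- by move=> s _; rewrite lee_fin powR_ge0.
pose F s : \bar R := (s `^ r * density_real s)%:E.
transitivity (\int[mu]_(s in Rp) F s)%E.
  apply: eq_integral => s; rewrite inE /= in_itv/= andbT => s0.
  by rewrite density_funE// -EFinM.
transitivity (\int[mu]_(s in `]0%R, N[) F s)%E.
  have -> : (`]0%R, N[%classic : set R) = Rp `&` `]0, N[.
    apply/seteqP; split => s /=; rewrite !in_itv/=; first by move=> /andP[-> ->].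
    by move=> [_ ->].
  rewrite integral_mkcondr; apply: eq_integral => s; rewrite inE /= in_itv/= andbT => s0.
  rewrite /patch; case: ifPn => //; rewrite notin_setE/= in_itv/= s0/= => /negP sN.
  by rewrite /F /density_real (negbTE sN) mulr0.
(* Since (s/N)^g = (1 - g t) s^g, the argument of the series is g t (1 - (s/N)^g), and each term
   takes the Beta form. *)
pose f n s : R := K * density_coef x y n * (g * t) ^+ n *
     (s `^ r * (1 - (s / N) `^ g) ^+ n).
transitivity (\int[mu]_(s in `]0%R, N[) (\sum_(n <oo) (f n s)%:E))%E.
  apply: eq_integral => s; rewrite inE /= in_itv/= => sI; have /andP[s0 sN] := sI.
  apply/esym/cvg_nneseries; rewrite /density_real sN.
  have -> : f ^~ s = (fun n => (s `^ r * K) *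
      (density_coef x y n * gauss_arg t s ^+ n)).
    apply/funext => n; rewrite /f gauss_argE cutoff_powR ?e_gt0//.
    by rewrite [in RHS]exprMn; ring.
  have -> : series (fun n => s `^ r * K * (density_coef x y n * gauss_arg t s ^+ n)) =
    (fun n => s `^ r * K * series (fun n => density_coef x y n * gauss_arg t s ^+ n) n).
    by apply/funext => n; rewrite /series/= mulr_sumr.
  rewrite mulrA; apply: cvgM; first exact: cvg_cst.
  exact: density_series_cvg.
rewrite integral_nneseries//; last 2 first.
- move=> n; apply/measurable_EFinP; apply: measurable_funTS.
  apply: measurable_funM => //; apply: measurable_funM.
    exact: measurable_powR.
  apply: measurable_funX; apply: measurable_funB => //.
  apply: (measurableT_comp (measurable_powR g)).
  exact: measurable_funM.
- move=> n s /=; rewrite in_itv/= => /andP[s0 sN]; rewrite lee_fin mulr_ge0//.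
    exact: density_weight_ge0.
  rewrite mulr_ge0 ?powR_ge0// exprn_ge0// cutoff_powR ?e_gt0// subr_ge0.
  by rewrite ltW// cutoff_lt1// e_gt0.
under eq_eseriesr do rewrite density_term_integral.
apply: cvg_nneseries.
have -> : series (fun n => e `^ ((1 - r) / g) * (gc n.+1 * (g * t) ^+ n.+1)) =
  (fun n => e `^ ((1 - r) / g) * series (fun n => gc n.+1 * (g * t) ^+ n.+1) n).
  by apply/funext => n; rewrite /series/= mulr_sumr.
by apply: cvgM; [exact: cvg_cst|exact: gauss_tail_cvg].
Qed.

Lemma u_moment :
  (\int[u_measure g theta t]_(s in Rp) (s `^ r))%R =
  e `^ ((1 - r) / g) * powser gc (g * t).
Proof.
have mp : measurable_fun Rp (fun s => (s `^ r)%:E).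
  by apply/measurable_EFinP; apply: measurable_funTS; exact: measurable_powR.
rewrite /Rintegral /u_measure ge0_integral_measure_add//; last first.
  by move=> s _; rewrite lee_fin powR_ge0.
rewrite density_moment ge0_integral_mscale//; last first.
  by move=> s _; rewrite lee_fin powR_ge0.
rewrite integral_dirac// diracE mem_set/=; last by rewrite /= in_itv/= andbT; exact: N0.
rewrite mul1r.
have -> : e `^ x * (e `^ (- x)) `^ r = e `^ ((1 - r) / g).
  rewrite -powRrM -powRD; last by rewrite (gt_eqF e_gt0) implybT.
  by congr (_ `^ _); ring.
by ring.
Qed.

End fixed_time.

End moments.

(** * Limits at the blow-up time *)

Section limits.
Context {R : realType}.
Implicit Types (g theta t r s w e : R).

Lemma cvg_left_side {T : Type} (F : set_system T) {FF : Filter F} (f : T -> R) (l : R) :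
  f @ F --> l -> (\forall a \near F, f a < l) -> f @ F --> l^'-.
Proof.
move=> fl flt P /= Pl; have := fl _ Pl; rewrite /= !nbhs_simpl/= => h.
by move: flt h; apply: filterS2 => a fa; apply.
Qed.

Lemma near_itv_left g : 0 < g -> \forall t \near (g^-1)^'-, 0 < t < g^-1.
Proof.
move=> g0; near=> t; apply/andP; split; last by [].
by near: t; apply: nbhs_left_gt; rewrite invr_gt0.
Unshelve. all: by end_near. Qed.

Lemma cvg_scale_left g : 0 < g -> g * t @[t --> (g^-1)^'-] --> 1^'-.
Proof.
move=> g0; apply: cvg_left_side.
  rewrite -[X in _ --> X](@mulfV _ g) ?gt_eqF//.
  apply: cvg_at_left_filter; apply: cvgM; [exact: cvg_cst|exact: cvg_id].
by near=> t; rewrite mulrC -ltr_pdivlMr// mul1r.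
Unshelve. all: by end_near. Qed.

Lemma continuous_powR a b : 0 < a -> {for a, continuous (fun s => s `^ b : R)}.
Proof.
move=> a0; apply: differentiable_continuous; apply/derivable1_diffP.
by have [] := is_derive1_powR b a0.
Qed.

Variables (g theta w : R) (g0 : 0 < g) (th1 : 1 < theta).
Hypothesis wE : sqrtC (1 - theta)%:C = 0 +i* w.
Hypothesis w2 : w ^+ 2 = theta - 1.
Local Notation x := (g^-1).
Local Notation y := (w / g).
Local Notation G := (sqnorm (Gamma (x +i* y))).

Let x0 : 0 < x. Proof. by rewrite invr_gt0. Qed.

(** The density is rewritten as theta t times the normalised series at z = [gauss_arg g t s], times
    (1 + g t s^g)^(-2/g), by means of 1 - z = (1 - g t)(1 + g t s^g). As t -> 1/g, z tends to 1 from
    the left. *)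
Lemma u_density_cvg s : 0 < s ->
  u_density g theta t s @[t --> x^'-] -->
  (g * gamR (2 / g) / G * (1 + s `^ g) `^ (- (2 / g)))%:C.
Proof.
move=> s0; have [_ hL] := powser_density y x0.
have G0 : 0 < G by exact: sqGamma_gt0.
have xx : x + x = 2 / g by rewrite mulrDl mul1r.
have gE : g * g^-1 = 1 by rewrite mulfV// gt_eqF.
(* The support ends at a point that tends to infinity, so a fixed s is eventually inside;
   explicitly, as soon as 1 - g t < s^(-g). *)
have near_cutoff : \forall t \near x^'-, s < cutoff g t.
  near=> t; have /andP[t0 t1] : 0 < t < x by near: t; exact: near_itv_left.
  rewrite /cutoff -heaviside_pos ?(e_gt0 g0 t1)// subr_gt0 -ltr_pdivlMr// mul1r.
  have -> : s^-1 = (s `^ (- g)) `^ x.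
    by rewrite -powRrM mulNr gE powR_inv1// ltW.
  apply: gt0_ltr_powR => //; rewrite ?nnegrE ?powR_ge0//; first exact: ltW (e_gt0 g0 t1).
  rewrite ltrBlDl -ltrBlDr -ltr_pdivrMl//; near: t; apply: nbhs_left_gt.
  by rewrite mulrBr mulr1 gtrBl mulr_gt0// powR_gt0.
have arg_cvg : gauss_arg g t s @[t --> x^'-] --> 1^'-.
  apply: cvg_left_side.
    rewrite -[X in _ --> X](_ : g * x * (1 + (g * x - 1) * s `^ g) = 1); last first.
      by rewrite gE subrr mul0r addr0 mulr1.
    apply: cvg_at_left_filter; rewrite /gauss_arg.
    have c1 : g * t @[t --> x] --> g * x.
      by apply: cvgM; [exact: cvg_cst|exact: cvg_id].
    apply: cvgM => //; apply: cvgD; first exact: cvg_cst.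
    apply: cvgM; last exact: cvg_cst.
    by apply: cvgB => //; exact: cvg_cst.
  near=> t; have /andP[t0 t1] : 0 < t < x by near: t; exact: near_itv_left.
  have sN : s < cutoff g t by near: t.
  by have /andP[] := gauss_arg_itv g0 t0 t1 s0 sN.
have scale_cvg : (1 + g * t * s `^ g) `^ (- (2 / g)) @[t --> x^'-] -->
    (1 + s `^ g) `^ (- (2 / g)).
  apply: (@cvg_comp _ _ _ (fun t => 1 + g * t * s `^ g) (fun a => a `^ (- (2 / g)))
    _ (nbhs (1 + s `^ g))); last first.
    by apply: continuous_powR; rewrite addr_gt0// powR_gt0.
  apply: cvg_at_left_filter.
  have -> : 1 + s `^ g = 1 + g * x * s `^ g by rewrite gE mul1r.
  apply: cvgD; first exact: cvg_cst.
  apply: cvgM; last exact: cvg_cst.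
  by apply: cvgM; [exact: cvg_cst|exact: cvg_id].
have -> : g * gamR (2 / g) / G * (1 + s `^ g) `^ (- (2 / g)) =
  theta * x * (gamR (x + x) / ((x ^+ 2 + y ^+ 2) * G)) * (1 + s `^ g) `^ (- (2 / g)).
  congr (_ * _); rewrite (sqnorm_sigma g0 w2) xx; field.
  by rewrite !gt_eqF// (lt_trans _ th1).
apply: (@cvg_trans _ ((theta * t * (powser (density_coef x y) (gauss_arg g t s) *
    (1 - gauss_arg g t s) `^ (x + x)) * (1 + g * t * s `^ g) `^ (- (2 / g)))%:C
    @[t --> x^'-])).
  apply: near_eq_cvg; near=> t.
  have /andP[t0 t1] : 0 < t < x by near: t; exact: near_itv_left.
  have sN : s < cutoff g t by near: t.
  rewrite (u_densityE g0 wE t0 t1 s0) /density_real sN; congr (_%:C).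
  have -> : 1 - gauss_arg g t s = (1 - g * t) * (1 + g * t * s `^ g).
    by rewrite /gauss_arg; ring.
  have k0 : 0 < 1 + g * t * s `^ g by rewrite addr_gt0// !mulr_gt0// powR_gt0.
  rewrite powRM ?(ltW k0) ?(ltW (e_gt0 g0 t1))// xx powRN.
  have : (1 + g * t * s `^ g) `^ (2 / g) != 0 by rewrite gt_eqF// powR_gt0.
  by move: (_ `^ (2 / g)) (_ `^ (2 / g)) => a b b0; field.
apply: cvg_real_complex; apply: cvgM => //; apply: cvgM.
  apply: cvgM; first exact: cvg_cst.
  by apply: cvg_at_left_filter; exact: cvg_id.
exact: (@cvg_comp _ _ _ _ (fun z => powser (density_coef x y) z * (1 - z) `^ (x + x))
  _ _ _ arg_cvg hL).
Unshelve. all: by end_near. Qed.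

(** With p = (r+1)/g, r > 1 means p > 2x; then Gauss's sum at 1 and Abel's theorem apply, with p -
    2x = (r-1)/g and p - x = r/g. *)
Lemma u_moment_cvg_gt r : 1 < r ->
  ((1 - g * t) `^ ((r - 1) / g) *
    \int[u_measure g theta t]_(s in `]0, +oo[) (s `^ r))%:C @[t --> x^'-] -->
  (gamR ((r + 1) / g) * gamR ((r - 1) / g) / sqnorm (Gamma ((r / g) +i* y)))%:C.
Proof.
move=> r1; have r0 : 0 < r by rewrite (lt_trans _ r1).
have px : x + x < (r + 1) / g by rewrite -mulr2n -mulr_natl ltr_pM2r// ltrD2r.
have h := gauss_summation (y := y) x0 px.
have {h} := powser_abel (fun n => gauss_coef_ge0 y n x0 (lt_trans (addr_gt0 x0 x0) px)) h.
have -> : (r + 1) / g - (x + x) = (r - 1) / g by field; rewrite gt_eqF.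
have -> : (r + 1) / g - x = r / g by field; rewrite gt_eqF.
move=> h; apply: (@cvg_trans _ ((powser (gauss_coef x y ((r + 1) / g)) (g * t))%:C
    @[t --> x^'-])).
  apply: near_eq_cvg; near=> t.
  have /andP[t0 t1] : 0 < t < x by near: t; exact: near_itv_left.
  rewrite (u_moment g0 th1 wE w2 t0 t1 r0) mulrA -powRD; last first.
    by rewrite (gt_eqF (e_gt0 g0 t1)) implybT.
  have -> : (r - 1) / g + (1 - r) / g = 0 by ring.
  by rewrite powRr0 mul1r.
apply: cvg_real_complex; exact: cvg_comp (cvg_scale_left g0) h.
Unshelve. all: by end_near. Qed.

(** At r = 1 the power of 1 - g t in the moment is trivial and p = 2x, so the growth is purely
    logarithmic. *)
Lemma u_moment_cvg_eq :
  (-1 / ln (1 - g * t) * \int[u_measure g theta t]_(s in `]0, +oo[) s)%:C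
    @[t --> x^'-] --> (gamR (2 / g) / G)%:C.
Proof.
have [_ h] := powser_gauss_eq y x0.
have xx : x + x = 2 / g by rewrite mulrDl mul1r.
rewrite -xx; apply: (@cvg_trans _
    ((powser (gauss_coef x y (x + x)) (g * t) / (- ln (1 - g * t)))%:C @[t --> x^'-])).
  apply: near_eq_cvg; near=> t.
  have /andP[t0 t1] : 0 < t < x by near: t; exact: near_itv_left.
  have -> : \int[u_measure g theta t]_(s in `]0, +oo[) s =
      \int[u_measure g theta t]_(s in `]0, +oo[) (s `^ 1).
    apply: eq_Rintegral => s; rewrite inE /= in_itv/= andbT => s0.
    by rewrite powRr1// ltW.
  rewrite (u_moment g0 th1 wE w2 t0 t1 ltr01) subrr mul0r powRr0 mul1r.
  have -> : (1 + 1) / g = x + x by rewrite mulrDl mul1r.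
  by congr (_%:C); rewrite invrN mulrN mulN1r mulNr mulrC.
apply: cvg_real_complex; exact: (@cvg_comp _ _ _ _
  (fun z => powser (gauss_coef x y (x + x)) z / (- ln (1 - z))) _ _ _ (cvg_scale_left g0) h).
Unshelve. all: by end_near. Qed.

Lemma u_moment_cvg_lt r : 0 < r < 1 ->
  (\int[u_measure g theta t]_(s in `]0, +oo[) (s `^ r))%:C @[t --> x^'-] -->
  (gamR ((r + 1) / g) * gamR ((1 - r) / g) / G)%:C.
Proof.
move=> /andP[r0 r1].
have px : (r + 1) / g < x + x by rewrite -mulr2n -[ltRHS]mulr_natl ltr_pM2r// ltrD2r.
have p0 : 0 < (r + 1) / g by rewrite divr_gt0// addr_gt0.
have [_] := powser_gauss_lt y x0 p0 px.
have -> : x + x - (r + 1) / g = (1 - r) / g by field; rewrite gt_eqF.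
move=> h; apply: (@cvg_trans _ ((powser (gauss_coef x y ((r + 1) / g)) (g * t) *
    (1 - g * t) `^ ((1 - r) / g))%:C @[t --> x^'-])).
  apply: near_eq_cvg; near=> t.
  have /andP[t0 t1] : 0 < t < x by near: t; exact: near_itv_left.
  by rewrite (u_moment g0 th1 wE w2 t0 t1 r0) mulrC.
apply: cvg_real_complex; exact: (@cvg_comp _ _ _ _
  (fun z => powser (gauss_coef x y ((r + 1) / g)) z * (1 - z) `^ ((1 - r) / g))
  _ _ _ (cvg_scale_left g0) h).
Unshelve. all: by end_near. Qed.

Lemma Gamma_sigma_mul :
  Gamma (sigma1 theta / g%:C) * Gamma (sigma2 theta / g%:C) = G%:C.
Proof.
by rewrite (sigma1_div g wE) (sigma2_div g wE) mulrC Gamma_mul_conj.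
Qed.

(** Subtracting sigma_1 and sigma_2 from r + 1 leaves r + iw and r - iw, again a conjugate pair with
    positive real part. *)
Lemma Gamma_sigma_sub_mul r : 0 < r ->
  Gamma ((r%:C + 1 - sigma1 theta) / g%:C) *
  Gamma ((r%:C + 1 - sigma2 theta) / g%:C) = (sqnorm (Gamma ((r / g) +i* y)))%:C.
Proof.
move=> r0.
have -> : r%:C + 1 - sigma1 theta = r +i* w.
  by rewrite /sigma1 wE; apply/eqP; rewrite eq_complex/=; apply/andP; split; apply/eqP; ring.
have -> : r%:C + 1 - sigma2 theta = r +i* (- w).
  by rewrite /sigma2 wE; apply/eqP; rewrite eq_complex/=; apply/andP; split; apply/eqP; ring.
rewrite !divc_real mulNr -[_ +i* (- _)]/((r / g +i* (w / g))^*).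
by rewrite Gamma_mul_conj//= divr_gt0.
Qed.

End limits.

Theorem corollary1p2 (R : realType) (gamma theta : R) :
  0 < gamma -> 1 < theta ->
  let g := gamma%:C in
  let s1 := sigma1 theta in
  let s2 := sigma2 theta in
  let u := u_measure gamma theta in
  [/\ forall x : R, 0 < x ->
        u_density gamma theta t x @[t --> (gamma^-1)^'-] -->
          g * Gamma (2 / g) / (Gamma (s1 / g) * Gamma (s2 / g)) *
          ((1 + x `^ gamma) `^ (- (2 / gamma)))%:C,
      forall r : R, 1 < r ->
        ((1 - gamma * t) `^ ((r - 1) / gamma) *
          \int[u t]_(x in `]0, +oo[) (x `^ r))%:C @[t --> (gamma^-1)^'-] -->
          Gamma ((r%:C + 1) / g) * Gamma ((r%:C - 1) / g) /
          (Gamma ((r%:C + 1 - s1) / g) * Gamma ((r%:C + 1 - s2) / g)),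
      (-1 / ln (1 - gamma * t) *
          \int[u t]_(x in `]0, +oo[) x)%:C @[t --> (gamma^-1)^'-] -->
          Gamma (2 / g) / (Gamma (s1 / g) * Gamma (s2 / g)) &
      forall r : R, 0 < r < 1 ->
        (\int[u t]_(x in `]0, +oo[) (x `^ r))%:C @[t --> (gamma^-1)^'-] -->
          Gamma ((r%:C + 1) / g) * Gamma ((1 - r%:C) / g) /
          (Gamma (s1 / g) * Gamma (s2 / g))].
Proof.
move=> g0 th1 g s1 s2 u; have [w wE w2] := sqrtC_neg th1.
have E2 : Gamma (2 / g) = (gamR (2 / gamma))%:C.
  by rewrite -Gamma_real /g rmorphM/= fmorphV rmorph_nat.
have Ep (r : R) : Gamma ((r%:C + 1) / g) = (gamR ((r + 1) / gamma))%:C.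
  by rewrite -Gamma_real /g rmorphM/= fmorphV rmorphD rmorph1.
have Em (r : R) : Gamma ((r%:C - 1) / g) = (gamR ((r - 1) / gamma))%:C.
  by rewrite -Gamma_real /g rmorphM/= fmorphV rmorphB rmorph1.
have En (r : R) : Gamma ((1 - r%:C) / g) = (gamR ((1 - r) / gamma))%:C.
  by rewrite -Gamma_real /g rmorphM/= fmorphV rmorphB rmorph1.
have Es := Gamma_sigma_mul g0 wE.
split.
- move=> x x0; rewrite Es E2 /g -fmorphV -!rmorphM.
  exact: (u_density_cvg g0 th1 wE w2 x0).
- move=> r r1; rewrite Ep Em (Gamma_sigma_sub_mul g0 wE (lt_trans ltr01 r1)).
  by rewrite -fmorphV -!rmorphM; exact: (u_moment_cvg_gt g0 th1 wE w2 r1).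
- by rewrite Es E2 -fmorphV -rmorphM; exact: (u_moment_cvg_eq g0 th1 wE w2).
- move=> r r01; rewrite Ep En Es -fmorphV -!rmorphM.
  exact: (u_moment_cvg_lt g0 th1 wE w2 r01).
Qed.
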